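(* Let $\theta\in[0,1)$. Let $\varphi:z\in\mathbb{D}\mapsto e^{2i\pi\theta}z$ where $\mathbb{D}$ is the closed unit disk in $\mathbb{C}$. Then $C(\mathbb{D})\rtimes_\varphi\mathbb{Z}$ is *-isomorphic to $$\{f\in C([0,1],\mathcal{A}_\theta): f(0)\in C^*(U)\},$$ where $\mathcal{A}_\theta=C^*(U,V)$ is the universal C*-algebra generated by two unitaries $U,V$ such that $VU=e^{2i\pi\theta}UV$.
   Context: For a homeomorphism $\varphi$ of $\mathbb{D}$, $C(\mathbb{D})\rtimes_\varphi\mathbb{Z}$ is the universal C*-algebra generated by $C(\mathbb{D})$ and a unitary $U_\varphi$ with $U_\varphi^*fU_\varphi=f\circ\varphi$ for all $f\in C(\mathbb{D})$. $C^*(U)$ is the C*-subalgebra of $\mathcal{A}_\theta$ generated by $U$. *)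

(* Defs.v *)
From HB Require Import structures.
From mathcomp Require Import all_boot all_order all_algebra.
From mathcomp Require Import all_classical all_reals all_analysis.
From mathcomp Require Import complex.

Set Implicit Arguments.
Unset Strict Implicit.
Unset Printing Implicit Defensive.

Import Order.TTheory GRing.Theory Num.Theory.
Import numFieldNormedType.Exports.

Local Open Scope classical_set_scope.
Local Open Scope complex_scope.
Local Open Scope ring_scope.

HB.mixin Record Algebra_isStarAlgebra (R : realType) A
    of GRing.Algebra R[i] A := {
  star : A -> A;
  starK : involutive star;
  starD : {morph star : x y / x + y};
  starM : forall x y, star (x * y) = star y * star x;
  starZ : forall (c : R[i]) x, star (c *: x) = c^* *: star x
}.

#[short(type="starAlgType")]
HB.structure Definition StarAlgebra (R : realType) :=
  {A of Algebra_isStarAlgebra R A & GRing.Algebra R[i] A}.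

HB.mixin Record isStarMorphism (R : realType) (A B : starAlgType R)
    (f : A -> B) := {
  star_morph : {morph f : x / star x}
}.

HB.structure Definition StarMorphism (R : realType) (A B : starAlgType R) :=
  {f of isStarMorphism R A B f & @GRing.LRMorphism R[i] A B *:%R f}.

Notation "{ 'starhom' A -> B }" := (@StarMorphism.type _ A%type B%type)
  (at level 0, A at level 98, B at level 99) : type_scope.

(* The library hierarchy has no join of rings and normed modules, so the ring
   operations are fields here and StarAlgebra is recovered below. *)
HB.mixin Record CompleteNormedModule_isCStarAlgebra (R : realType) A
    of CompleteNormedModule R[i] A := {
  cstar_one : A;
  cstar_mul : A -> A -> A;
  cstar_star : A -> A;
  cstar_mulA : associative cstar_mul;
  cstar_mul1l : left_id cstar_one cstar_mul;
  cstar_mul1r : right_id cstar_one cstar_mul;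
  cstar_mulDl : left_distributive cstar_mul +%R;
  cstar_mulDr : right_distributive cstar_mul +%R;
  cstar_one_neq0 : cstar_one != 0;
  cstar_scalerAl : forall (c : R[i]) x y,
    c *: cstar_mul x y = cstar_mul (c *: x) y;
  cstar_scalerAr : forall (c : R[i]) x y,
    c *: cstar_mul x y = cstar_mul x (c *: y);
  cstar_starK : involutive cstar_star;
  cstar_starD : {morph cstar_star : x y / x + y};
  cstar_starM : forall x y,
    cstar_star (cstar_mul x y) = cstar_mul (cstar_star y) (cstar_star x);
  cstar_starZ : forall (c : R[i]) x,
    cstar_star (c *: x) = c^* *: cstar_star x;
  cstar_normM : forall x y : A, `|cstar_mul x y| <= `|x| * `|y|;
  cstar_norm_identity : forall x : A,
    `|cstar_mul (cstar_star x) x| = `|x| ^+ 2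
}.

#[short(type="cstarAlgType")]
HB.structure Definition CStarAlgebra (R : realType) :=
  {A of CompleteNormedModule_isCStarAlgebra R A & CompleteNormedModule R[i] A}.

Section CStarAlgebra_isStarAlgebra.
Context (R : realType) (A : cstarAlgType R).

#[non_forgetful_inheritance]
HB.instance Definition _ := GRing.Zmodule_isNzRing.Build (CStarAlgebra.sort A)
  cstar_mulA cstar_mul1l cstar_mul1r cstar_mulDl cstar_mulDr cstar_one_neq0.

#[non_forgetful_inheritance]
HB.instance Definition _ := GRing.LSemiModule_isLSemiAlgebra.Build R[i]
  (CStarAlgebra.sort A) cstar_scalerAl.

#[non_forgetful_inheritance]
HB.instance Definition _ := GRing.LSemiAlgebra_isSemiAlgebra.Build R[i]
  (CStarAlgebra.sort A) cstar_scalerAr.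

#[non_forgetful_inheritance]
HB.instance Definition _ := Algebra_isStarAlgebra.Build R
  (CStarAlgebra.sort A) cstar_starK cstar_starD cstar_starM cstar_starZ.

End CStarAlgebra_isStarAlgebra.

Section theory.
Context {R : realType} (A : cstarAlgType R).
Implicit Types x y : A.

Lemma cstar_normrM x y : `|x * y| <= `|x| * `|y|.
Proof. exact: cstar_normM. Qed.

Lemma cstar_identity x : `|star x * x| = `|x| ^+ 2.
Proof. exact: cstar_norm_identity. Qed.

Lemma star0 : star (0 : A) = 0.
Proof. by rewrite -[0 in LHS](scale0r (0 : A)) starZ rmorph0 scale0r. Qed.

Lemma starN x : star (- x) = - star x.
Proof. by rewrite -scaleN1r starZ rmorphN1 scaleN1r. Qed.

Lemma starB x y : star (x - y) = star x - star y.
Proof. by rewrite starD starN. Qed.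

Lemma star1 : star (1 : A) = 1.
Proof. by rewrite -[RHS]starK -[star 1 in RHS]mul1r starM starK mul1r. Qed.

Let le_norm_star x : `|x| <= `|star x|.
Proof.
have [->|x0] := eqVneq x 0; first by rewrite normr0.
rewrite -(ler_pM2r (x:=`|x|)) ?normr_gt0// -expr2 -cstar_identity.
exact: cstar_normrM.
Qed.

Lemma norm_star x : `|star x| = `|x|.
Proof.
by apply/le_anti/andP; split; last exact: le_norm_star;
   rewrite -[in leRHS](starK x) le_norm_star.
Qed.

Lemma star_continuous : continuous (@star R A).
Proof.
move=> x; apply/cvgrPdist_lt => e e0; near=> y.
rewrite -starB norm_star; near: y; exact: cvgr_dist_lt.
Unshelve. all: by end_near. Qed.

Lemma cstar_cvgM (T : Type) (F : set_system T) (FF : Filter F) (f g : T -> A)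
    x y : f @ F --> x -> g @ F --> y -> (fun t => f t * g t) @ F --> x * y.
Proof.
move=> fx gy; apply/cvgrPdist_lt => e e0.
have x1 : 0 < 2 * (`|x| + 1) by rewrite mulr_gt0// ltr_wpDl.
have y1 : 0 < 2 * (`|y| + 1) by rewrite mulr_gt0// ltr_wpDl.
near=> t.
have gt1 : `|y - g t| < 1 by near: t; exact: cvgr_dist_lt.
have gt2 : `|y - g t| < e / (2 * (`|x| + 1)).
  by near: t; apply: cvgr_dist_lt => //; rewrite divr_gt0.
have ft : `|x - f t| < e / (2 * (`|y| + 1)).
  by near: t; apply: cvgr_dist_lt => //; rewrite divr_gt0.
have -> : x * y - f t * g t = x * (y - g t) + (x - f t) * g t.
  by rewrite mulrBr mulrBl addrA subrK.
apply: (le_lt_trans (ler_normD _ _)).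
rewrite (splitr e); apply: ler_ltD.
  apply: (le_trans (cstar_normrM _ _)).
  apply: (@le_trans _ _ ((`|x| + 1) * (e / (2 * (`|x| + 1))))).
    by apply: ler_pM => //; [rewrite lerDl|exact: ltW].
  by rewrite mulrCA invfM [X in e * X]mulrCA divff ?mulr1// gt_eqF// ltr_wpDl.
apply: (le_lt_trans (cstar_normrM _ _)).
have gy1 : `|g t| <= `|y| + 1.
  rewrite -[g t](subKr y); apply: (le_trans (ler_normB _ _)).
  by rewrite lerD2l ltW.
apply: (@le_lt_trans _ _ (`|x - f t| * (`|y| + 1))).
  exact: ler_wpM2l.
by rewrite -ltr_pdivlMr ?ltr_wpDl// -mulrA -invfM.
Unshelve. all: by end_near. Qed.

End theory.

Section complex_cstar.
Context (R : realType).
Local Notation C := R[i].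

HB.instance Definition _ := NormedModule.copy R[i] R[i]^o.
Implicit Types (z : C) (F : set_system C).

Let normc_ge_Im z : `|complex.Im z|%:C <= `|z|.
Proof.
by rewrite normc_def lecR -sqrtr_sqr ler_wsqrtr// lerDr sqr_ge0.
Qed.

Let normc_le_ReIm z : `|z| <= `|complex.Re z|%:C + `|complex.Im z|%:C.
Proof.
rewrite {1}[z]complexE (le_trans (ler_normD _ _))// normrM.
by rewrite !normc_def/= !expr0n/= expr1n add0r addr0 sqrtr1 mul1r addr0 !sqrtr_sqr.
Qed.

Let cvg_lipschitz (g : {additive C -> R}) F : ProperFilter F ->
  (forall z, `|g z|%:C <= `|z|) -> cauchy F -> cvg (g @ F).
Proof.
move=> FF gle /cauchyP Fc; apply: R_complete; apply/cauchyP => e e0.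
have /Fc[z Fz] : 0 < e%:C by rewrite ltcR.
exists (g z); change (F (g @^-1` ball (g z) e)); apply: filterS Fz => w.
move=> zw; change (`|g z - g w| < e); rewrite -raddfB -ltcR.
exact: le_lt_trans (gle _) zw.
Qed.

Let complex_complete F : ProperFilter F -> cauchy F -> cvg F.
Proof.
move=> FF Fc.
have /cvg_ex[/= a Fa] := @cvg_lipschitz _ F FF (@normc_ge_Re R) Fc.
have /cvg_ex[/= b Fb] := @cvg_lipschitz _ F FF normc_ge_Im Fc.
apply/cvg_ex; exists (a +i* b); apply/cvgrPdist_lt => -[x y].
rewrite ltcE /= => /andP[/eqP y0 x0]; rewrite {}y0 -/(x%:C).
near=> z.
rewrite (le_lt_trans (normc_le_ReIm _))// -rmorphD ltcR/= !raddfB/=.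
rewrite (splitr x) ltrD//.
  by near: z; apply: cvgr_dist_lt => //; exact: divr_gt0.
by near: z; apply: cvgr_dist_lt => //; exact: divr_gt0.
Unshelve. all: by end_near. Qed.

HB.instance Definition _ := Uniform_isComplete.Build C complex_complete.

Let scaleA (c : R[i]) (x y : C) : c *: (x * y : C) = (c *: x : C) * y.
Proof. exact: mulrA. Qed.
Let scaleAr (c : R[i]) (x y : C) : c *: (x * y : C) = x * (c *: y : C).
Proof. exact: mulrCA. Qed.
Let conjK : involutive (@Num.conj R[i] : C -> C).
Proof. exact: conjCK. Qed.
Let conjD : {morph (@Num.conj R[i] : C -> C) : x y / x + y}.
Proof. exact: rmorphD. Qed.
Let conjM (x y : C) : (x * y)^* = y^* * x^* :> C.
Proof. by rewrite rmorphM mulrC. Qed.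
Let conjZ (c : R[i]) (x : C) : (c *: x)^* = c^* *: (x^* : C) :> C.
Proof. exact: rmorphM. Qed.
Let normM (x y : C) : `|x * y| <= `|x| * `|y|.
Proof. by rewrite normrM. Qed.
Let normI (x : C) : `|(x^* : C) * x| = `|x| ^+ 2.
Proof. by rewrite normrM norm_conjC expr2. Qed.

HB.instance Definition _ := CompleteNormedModule_isCStarAlgebra.Build R C
  (@mulrA C) (@mul1r C) (@mulr1 C) (@mulrDl C) (@mulrDr C) (@oner_neq0 C)
  scaleA scaleAr conjK conjD conjM conjZ normM normI.

End complex_cstar.

(* Pointwise operations; the base point of X makes 1 != 0, as the library's
   algebras are nontrivial rings. *)
Section contalg.
Context (R : realType) (X : ptopologicalType) (A : cstarAlgType R).
Implicit Types f g : continuousType X A.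

Let add_cts f g : continuous (f \+ g).
Proof. by move=> x; apply: cvgD; exact: cts_fun. Qed.
Let opp_cts f : continuous (\- f).
Proof. by move=> x; apply: cvgN; exact: cts_fun. Qed.
Let mul_cts f g : continuous (f \* g).
Proof. by move=> x; apply: cstar_cvgM; exact: cts_fun. Qed.
Let scale_cts (c : R[i]) f : continuous (fun x => c *: f x).
Proof. by move=> x; apply: cvgZ; [exact: cvg_cst|exact: cts_fun]. Qed.
Let star_cts f : continuous (fun x => star (f x)).
Proof.
by move=> x; apply: (continuous_comp (cts_fun _)); exact: star_continuous.
Qed.

Let addc f g : continuousType X A := mkcts (@add_cts f g).
Let oppc f : continuousType X A := mkcts (@opp_cts f).
Let mulc f g : continuousType X A := mkcts (@mul_cts f g).
Let scalec c f : continuousType X A := mkcts (@scale_cts c f).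
Let starc f : continuousType X A := mkcts (@star_cts f).

Let addcA : associative addc.
Proof. by move=> f g h; apply/continuousEP => x /=; exact: addrA. Qed.
Let addcC : commutative addc.
Proof. by move=> f g; apply/continuousEP => x /=; exact: addrC. Qed.
Let add0c : left_id (cst 0 : continuousType X A) addc.
Proof. by move=> f; apply/continuousEP => x /=; exact: add0r. Qed.
Let addNc : left_inverse (cst 0 : continuousType X A) oppc addc.
Proof. by move=> f; apply/continuousEP => x /=; exact: addNr. Qed.
HB.instance Definition _ :=
  GRing.isZmodule.Build (continuousType X A) addcA addcC add0c addNc.

Let mulcA : associative mulc.
Proof. by move=> f g h; apply/continuousEP => x /=; exact: mulrA. Qed.
Let mul1c : left_id (cst 1 : continuousType X A) mulc.
Proof. by move=> f; apply/continuousEP => x /=; exact: mul1r. Qed.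
Let mulc1 : right_id (cst 1 : continuousType X A) mulc.
Proof. by move=> f; apply/continuousEP => x /=; exact: mulr1. Qed.
Let mulcDl : left_distributive mulc +%R.
Proof. by move=> f g h; apply/continuousEP => x /=; exact: mulrDl. Qed.
Let mulcDr : right_distributive mulc +%R.
Proof. by move=> f g h; apply/continuousEP => x /=; exact: mulrDr. Qed.
Let onec_neq0 : (cst 1 : continuousType X A) != 0.
Proof. by apply/eqP => /continuousEP/(_ point)/eqP; rewrite oner_eq0. Qed.
HB.instance Definition _ := GRing.Zmodule_isNzRing.Build (continuousType X A)
  mulcA mul1c mulc1 mulcDl mulcDr onec_neq0.

Let scalecA (c d : R[i]) f : scalec c (scalec d f) = scalec (c * d) f.
Proof. by apply/continuousEP => x /=; exact: scalerA. Qed.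
Let scale1c : left_id 1 scalec.
Proof. by move=> f; apply/continuousEP => x /=; exact: scale1r. Qed.
Let scalecDr : right_distributive scalec +%R.
Proof. by move=> c f g; apply/continuousEP => x /=; exact: scalerDr. Qed.
Let scalecDl f : {morph scalec^~ f : c d / c + d}.
Proof. by move=> c d; apply/continuousEP => x /=; exact: scalerDl. Qed.
HB.instance Definition _ := GRing.Zmodule_isLmodule.Build R[i]
  (continuousType X A) scalecA scale1c scalecDr scalecDl.

Let scalecAl (c : R[i]) f g : c *: (f * g) = c *: f * g.
Proof. by apply/continuousEP => x /=; exact: scalerAl. Qed.
HB.instance Definition _ := GRing.LSemiModule_isLSemiAlgebra.Build R[i]
  (continuousType X A) scalecAl.

Let scalecAr (c : R[i]) f g : c *: (f * g) = f * (c *: g).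
Proof. by apply/continuousEP => x /=; exact: scalerAr. Qed.
HB.instance Definition _ := GRing.LSemiAlgebra_isSemiAlgebra.Build R[i]
  (continuousType X A) scalecAr.

Let starcK : involutive starc.
Proof. by move=> f; apply/continuousEP => x /=; exact: starK. Qed.
Let starcD : {morph starc : f g / f + g}.
Proof. by move=> f g; apply/continuousEP => x /=; exact: starD. Qed.
Let starcM f g : starc (f * g) = starc g * starc f.
Proof. by apply/continuousEP => x /=; exact: starM. Qed.
Let starcZ (c : R[i]) f : starc (c *: f) = c^* *: starc f.
Proof. by apply/continuousEP => x /=; exact: starZ. Qed.
HB.instance Definition _ := Algebra_isStarAlgebra.Build R (continuousType X A)
  starcK starcD starcM starcZ.

End contalg.

Section spaces.
Variable R : realType.

Definition closed_disk : set R[i] := [set z | `|z| <= 1].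

Definition disk : Type := closed_disk.
HB.instance Definition _ := Topological.on disk.
Let disk0 : (0 : R[i]) \in closed_disk.
Proof. by rewrite inE /closed_disk /= normr0. Qed.
HB.instance Definition _ := isPointed.Build disk (exist _ 0 disk0).

Definition unit_interval : Type := `[0 : R, 1]%classic.
HB.instance Definition _ := Topological.on unit_interval.
Let interval0 : (0 : R) \in `[0 : R, 1]%classic.
Proof. by rewrite inE /= in_itv/= lexx ler01. Qed.
Definition zeroI : unit_interval := exist _ 0 interval0.
HB.instance Definition _ := isPointed.Build unit_interval zeroI.

Definition expi (t : R) : R[i] := cos t +i* sin t.

Lemma norm_expi t : `|expi t| = 1.
Proof. by rewrite normc_def/= cos2Dsin2 sqrtr1. Qed.

Lemma expiD s t : expi (s + t) = expi s * expi t.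
Proof.
by rewrite /expi cosD sinD; apply/eqP; rewrite eq_complex/= eqxx addrC eqxx.
Qed.

Lemma expi0 : expi 0 = 1.
Proof. by rewrite /expi cos0 sin0. Qed.

Let rotation_in (theta : R) (z : disk) :
  expi (2 * pi * theta) * val z \in closed_disk.
Proof.
rewrite inE /closed_disk /= normrM norm_expi mul1r.
by case: z => z /=; rewrite inE.
Qed.

Definition rotation (theta : R) (z : disk) : disk :=
  exist _ (expi (2 * pi * theta) * val z) (rotation_in theta z).

Let rotation_continuous theta : continuous (rotation theta).
Proof.
have val_cts : continuous (fun z : disk => val z : R[i]).
  exact: (@initial_continuous disk R[i] (fun z => val z)).
apply/continuous_comp_initial => z.
exact: (@cvgMl_tmp _ _ (nbhs z) _ _ (expi (2 * pi * theta)) _ (val_cts z)).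
Qed.
HB.instance Definition _ theta :=
  isContinuous.Build disk disk (rotation theta) (@rotation_continuous theta).

Lemma rotationK theta : cancel (rotation theta) (rotation (- theta)).
Proof.
move=> z; apply: val_inj; rewrite /= mulrA -expiD mulrN addNr expi0.
exact: mul1r.
Qed.

End spaces.

Section universal_algebras.
Context {R : realType}.

Definition unitary (A : starAlgType R) (u : A) : Prop :=
  star u * u = 1 /\ u * star u = 1.

Definition cstar_subalgebra (A : cstarAlgType R) (S : set A) : Prop :=
  [/\ closed S, S 0, forall x y, S x -> S y -> S (x + y),
      forall (c : R[i]) x, S x -> S (c *: x) &
      (forall x y, S x -> S y -> S (x * y)) /\ forall x, S x -> S (star x)].

Definition cstar_generated (A : cstarAlgType R) (G : set A) : set A :=
  smallest (@cstar_subalgebra A) G.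

Definition covariant (phi : continuousType (disk R) (disk R))
    (B : starAlgType R) (rho : {starhom continuousType (disk R) R[i] -> B})
    (u : B) : Prop :=
  unitary u /\ forall f, star u * rho f * u = rho (f \o phi).

(* Uniqueness of the extending morphism follows from generation, because
   star-homomorphisms between C*-algebras are automatically continuous. *)
Record is_crossed_product (phi : continuousType (disk R) (disk R))
    (B : cstarAlgType R) (iota : {starhom continuousType (disk R) R[i] -> B})
    (W : B) : Prop := {
  crossed_product_covariant : covariant phi iota W;
  crossed_product_generated : cstar_generated (range iota `|` [set W]) = setT;
  crossed_product_universal : forall (D : cstarAlgType R)
    (rho : {starhom continuousType (disk R) R[i] -> D}) (u : D),
    covariant phi rho u ->
    exists Phi : {starhom B -> D}, (forall f, Phi (iota f) = rho f) /\ Phi W = u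
}.

Definition rotation_relation (theta : R) (A : starAlgType R) (u v : A) : Prop :=
  [/\ unitary u, unitary v & v * u = expi (2 * pi * theta) *: (u * v)].

Record is_rotation_algebra (theta : R) (A : cstarAlgType R) (U V : A) : Prop := {
  rotation_algebra_relation : rotation_relation theta U V;
  rotation_algebra_generated : cstar_generated [set U; V] = setT;
  rotation_algebra_universal : forall (D : cstarAlgType R) (u v : D),
    rotation_relation theta u v ->
    exists Phi : {starhom A -> D}, Phi U = u /\ Phi V = v
}.

End universal_algebras.

(* Main.v *)
Require Import Defs.
From HB Require Import structures.
From mathcomp Require Import all_boot all_order all_algebra.
From mathcomp Require Import all_classical all_reals all_analysis.
From mathcomp Require Import complex separable cyclic cyclotomic ring lra zify.

(** The relation [star W * z * W = expi (2 pi theta) z], for the coordinate [z]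
    of the disk, is the one satisfied by [U] and [t V] for every [t] in [0, 1].
    So the crossed product has representations [Phi t] in the rotation algebra
    with [Phi t W = U] and [Phi t f = f (t V)] for [f] on the disk, the latter
    being the continuous functional calculus; at [t = 0] they take values in
    the C*-algebra of [U]. The isomorphism sends [b] to the path
    [t |-> Phi t b].

    The analysis rests on one device. A finite sum of Fourier type has norm at
    most its number of terms times the supremum of its coefficients, and
    averaging over roots of unity bounds the coefficients by whatever norm is
    to be dominated ([coef_bound]). Applied to the powers of order [2 ^ k] of a
    normal element, whose number of terms grows only linearly, this crude
    estimate becomes sharp after extracting roots ([power_trick]). It gives
    three facts: [q V] has norm at most the supremum of the polynomial [q] on
    the circle ([horner_alg_bound]), from which the functional calculus is
    built by completion; conversely [q V] has norm at least this supremum,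
    because [V] can be rotated by automorphisms ([fcalc_ge]); and the
    representations [Phi t] are jointly isometric on the sums of the
    [star W ^ N f W ^ i], hence on the crossed product ([rep_isometric]).
    Morphisms of C*-algebras are contractive because a self-adjoint strict
    contraction is the average of two unitaries ([starhom_contractive]).

    Isometry gives injectivity and a closed range. The range contains the
    constant paths in the C*-algebra of [U] and all [t |-> g t a], where [g] is
    a cut-off vanishing near [0] and [a] is arbitrary: the set of such [a] is a
    C*-subalgebra containing [U] and [V] ([rep_cutoff]). Piecewise linear
    interpolation of a path [f] with [f 0] in the C*-algebra of [U] uses only
    these, so every such path is in the range ([rep_surjective]). *)

Set Implicit Arguments.
Unset Strict Implicit.
Unset Printing Implicit Defensive.

Import Order.TTheory GRing.Theory Num.Theory.
Import numFieldNormedType.Exports.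

Local Open Scope classical_set_scope.
Local Open Scope complex_scope.
Local Open Scope ring_scope.

(** * Real-valued norms *)

(** The norm of a module over the complex numbers is complex-valued; its real
    part is better suited to order reasoning, as the order of [R] is total. *)
Definition nrm (R : realType) (V : cstarAlgType R) (x : V) : R :=
  complex.Re `|x|.

Section real_valued_norm.
Context (R : realType).

Lemma normE (V : cstarAlgType R) (x : V) : `|x| = (nrm x)%:C.
Proof. by rewrite /nrm RRe_real// ger0_real. Qed.

Lemma nrm_le (V : cstarAlgType R) (x : V) (c : R) :
  (nrm x <= c) = (`|x| <= c%:C).
Proof. by rewrite normE lecR. Qed.

Lemma nrm_lt (V : cstarAlgType R) (x : V) (c : R) :
  (nrm x < c) = (`|x| < c%:C).
Proof. by rewrite normE ltcR. Qed.

Lemma nrm_ge0 (V : cstarAlgType R) (x : V) : 0 <= nrm x.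
Proof. by rewrite -ler0c -normE normr_ge0. Qed.

Lemma nrm0 (V : cstarAlgType R) : nrm (0 : V) = 0.
Proof. by rewrite /nrm normr0. Qed.

Lemma nrm_eq0 (V : cstarAlgType R) (x : V) : nrm x <= 0 -> x = 0.
Proof. by rewrite nrm_le normr_le0 => /eqP. Qed.

Lemma nrmD (V : cstarAlgType R) (x y : V) : nrm (x + y) <= nrm x + nrm y.
Proof. by rewrite nrm_le rmorphD/= -!normE ler_normD. Qed.

Lemma nrmN (V : cstarAlgType R) (x : V) : nrm (- x) = nrm x.
Proof. by rewrite /nrm normrN. Qed.

Lemma nrmBC (V : cstarAlgType R) (x y : V) : nrm (x - y) = nrm (y - x).
Proof. by rewrite -nrmN opprB. Qed.

Lemma nrmB_trans (V : cstarAlgType R) (z x y : V) :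
  nrm (x - y) <= nrm (x - z) + nrm (z - y).
Proof. by apply: le_trans (nrmD _ _); rewrite addrA subrK. Qed.

Lemma nrm_sum (V : cstarAlgType R) (I : Type) (r : seq I) (P : pred I)
    (F : I -> V) : nrm (\sum_(i <- r | P i) F i) <= \sum_(i <- r | P i) nrm (F i).
Proof.
elim/big_ind2 : _ => [||//]; first by rewrite nrm0.
by move=> x r1 y r2 h1 h2; apply: le_trans (nrmD _ _) _; exact: lerD.
Qed.

Lemma nrmZ (V : cstarAlgType R) (c : R[i]) (x : V) :
  nrm (c *: x) = nrm (c : R[i]) * nrm x.
Proof. by apply: complexI; rewrite rmorphM/= -!normE normrZ. Qed.

Lemma nrmcD (x y : R[i]) : nrm (x + y : R[i]) <= nrm x + nrm y.
Proof. by rewrite nrm_le rmorphD/= -!normE ler_normD. Qed.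

Lemma nrmcM (x y : R[i]) : nrm (x * y : R[i]) = nrm x * nrm y.
Proof. by apply: complexI; rewrite rmorphM/= -!normE normrM. Qed.

Lemma nrmcX (x : R[i]) n : nrm (x ^+ n : R[i]) = nrm x ^+ n.
Proof. by apply: complexI; rewrite rmorphXn/= -!normE normrX. Qed.

Lemma nrmc_real (x : R) : nrm (x%:C : R[i]) = `|x|.
Proof.
by rewrite /nrm normc_def /= expr0n addr0 sqrtr_sqr.
Qed.

Lemma nrmc_conj (x : R[i]) : nrm (x^* : R[i]) = nrm x.
Proof. by rewrite /nrm norm_conjC. Qed.

Context (A : cstarAlgType R).
Implicit Types x y : A.

Lemma nrmM x y : nrm (x * y) <= nrm x * nrm y.
Proof. by rewrite nrm_le rmorphM/= -!normE cstar_normrM. Qed.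

Lemma nrm_star x : nrm (star x) = nrm x.
Proof. by rewrite /nrm norm_star. Qed.

Lemma nrm_starM x : nrm (star x * x) = nrm x ^+ 2.
Proof. by apply: complexI; rewrite rmorphXn/= -!normE cstar_identity. Qed.

Lemma nrm1 : nrm (1 : A) = 1.
Proof.
have := nrm_starM (1 : A); rewrite star1 mul1r => /eqP.
rewrite -subr_eq0 expr2 -{1}[nrm (1 : A)]mulr1 -mulrBr mulf_eq0 => /orP[|].
  move=> /eqP h; have := @nrm_eq0 A (1 : A).
  by rewrite h lexx => /(_ isT)/eqP; rewrite oner_eq0.
by rewrite subr_eq0 => /eqP.
Qed.

Lemma nrm_unitary (u : A) : unitary u -> nrm u = 1.
Proof.
move=> [uu _]; have := nrm_starM u; rewrite uu nrm1 => /esym/eqP.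
by rewrite sqrp_eq1 ?nrm_ge0// => /eqP.
Qed.

Lemma nrm_unitaryl (u x : A) : unitary u -> nrm (u * x) = nrm x.
Proof.
move=> [uu _]; apply/eqP; rewrite -(@eqrXn2 _ 2) ?nrm_ge0// -!nrm_starM starM.
by rewrite -mulrA [star u * _]mulrA uu mul1r.
Qed.

Lemma nrm_unitaryr (u x : A) : unitary u -> nrm (x * u) = nrm x.
Proof.
move=> [uu uu']; rewrite -nrm_star starM nrm_unitaryl ?nrm_star//.
by split; rewrite starK.
Qed.

End real_valued_norm.

Section completeness.
Context (R : realType) (V : cstarAlgType R).

(** Completeness in the form used to construct limits: [P e a] stands for the
    element to be found being at distance at most [e] from [a]. *)
Lemma complete_approx (P : R -> V -> Prop) :
    (forall e, 0 < e -> exists a, P e a) ->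
    (forall e d a b, P e a -> P d b -> nrm (a - b) <= e + d) ->
  exists l, forall e a, 0 < e -> P e a -> nrm (l - a) <= e.
Proof.
move=> Pex Pcau.
(* A set belongs to [F] when it contains all good enough approximations. *)
pose F : set_system V := [set S | exists2 e, 0 < e &
  forall d a, 0 < d -> d <= e -> P d a -> S a].
have FF : ProperFilter F.
  apply: Build_ProperFilter.
    by move=> [e e0] H; have [a Pa] := Pex _ e0; exact: (H e a).
  split; first by exists 1.
    move=> S T [e e0 He] [d d0 Hd]; exists (Num.min e d); first by rewrite lt_min e0.
    by move=> c a c0; rewrite le_min => /andP[ce cd] Pa; split; [apply: He Pa|apply: Hd Pa].
  by move=> S T ST [e e0 He]; exists e => // d a d0 de Pa; apply: ST; exact: He Pa.
have Fl : cvg F.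
  apply: cauchy_cvg; apply/cauchyP => e e0.
  have [e' e'E] : exists e', e = e'%:C.
    by exists (complex.Re e); rewrite RRe_real// gtr0_real.
  have e'0 : 0 < e' by rewrite -ltcR -e'E.
  have e30 : 0 < e' / 3 by rewrite divr_gt0.
  have [a Pa] := Pex _ e30.
  exists a, (e' / 3) => // d b d0 de Pb.
  rewrite -ball_normE/= e'E -nrm_lt; apply: le_lt_trans (Pcau _ _ _ _ Pa Pb) _.
  lra.
have [l Hl] := (@cvg_ex _ F).1 Fl; exists l => e a e0 Pa.
apply/ler_addgt0Pr => d d0.
have d20 : 0 < (d / 2)%:C by rewrite ltcR divr_gt0.
have /= := Hl _ (nbhsx_ballx l _ d20).
move=> [c c0 Hc].
have [m [m0 mc md]] : exists m, [/\ 0 < m, m <= c & m <= d / 2].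
  exists (Num.min c (d / 2)); rewrite lt_min c0 divr_gt0//.
  by rewrite !ge_min !lexx orbT.
have [b Pb] := Pex m m0.
have := Hc m b m0 mc Pb; rewrite -ball_normE/= -nrm_lt => lb.
apply: le_trans (nrmB_trans b _ _) _.
have := Pcau _ _ _ _ Pb Pa; lra.
Qed.

End completeness.

Section cvg_nrm.
Context (R : realType) (V : cstarAlgType R).

Lemma closed_nrm (S : set V) : closed S <->
  (forall x, (forall e : R, 0 < e -> exists2 y, S y & nrm (x - y) < e) -> S x).
Proof.
split => [cS x H|H].
  apply: cS => B /nbhs_ballP[e /= e0 eB].
  have ee : e = (complex.Re e)%:C by rewrite RRe_real// gtr0_real.
  have [|y Sy xy] := H (complex.Re e); first by rewrite -ltcR -ee.
  exists y; split => //; apply: eB; rewrite -ball_normE/= ee -nrm_lt//.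
move=> x cx; apply: H => e e0.
have e0' : 0 < e%:C by rewrite ltcR.
have [y [Sy]] := cx _ (nbhsx_ballx x _ e0').
by rewrite -ball_normE/= -nrm_lt; exists y.
Qed.

Lemma nbhs_nrm (x : V) (S : set V) : nbhs x S <->
  exists2 e : R, 0 < e & forall y, nrm (x - y) < e -> S y.
Proof.
split => [/nbhs_ballP[e /= e0 eB]|[e e0 H]].
  have ee : e = (complex.Re e)%:C by rewrite RRe_real// gtr0_real.
  exists (complex.Re e); first by rewrite -ltcR -ee.
  by move=> y xy; apply: eB; rewrite -ball_normE/= ee -nrm_lt.
apply/nbhs_ballP; exists e%:C; first by rewrite /= ltcR.
by move=> y; rewrite -ball_normE/= -nrm_lt; exact: H.
Qed.

End cvg_nrm.

(** * Square roots and contractive morphisms *)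

Lemma exprn_small (R : realType) (r e : R) : 0 <= r < 1 -> 0 < e ->
  exists n, r ^+ n < e.
Proof.
move=> /andP[r0 r1] e0.
have rn : `|r| < 1 by rewrite ger0_norm.
have /cvgrPdist_lt/(_ e e0)[n _ /(_ n (leqnn n))/=] := cvg_expr rn.
by rewrite sub0r normrN ger0_norm ?exprn_ge0//; exists n.
Qed.

Lemma mulC2V (R : realType) (V : lmodType R[i]) (x y : V) :
  x = 2^-1 *: y -> y = x + x.
Proof. by move=> ->; rewrite -scalerDl -mulr2n -[_ *+ 2]mulr_natr mulVf ?scale1r. Qed.

Section square_root.
Context (R : realType) (A : cstarAlgType R) (x : A) (r : R).
Hypotheses (r0 : 0 < r) (r1 : r < 1) (xr : nrm x <= r).

Let step (y : A) : A := 2^-1 *: (x + y * y).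
Let y : nat -> A := fun n => iter n step (0 : A).

Let nrm_half (a : A) : nrm (2^-1 *: a) = 2^-1 * nrm a.
Proof.
have <- : (2^-1)%:C = 2^-1 :> R[i] by rewrite fmorphV rmorph_nat.
by rewrite nrmZ nrmc_real ger0_norm// invr_ge0.
Qed.

Let step_le a : nrm a <= r -> nrm (step a) <= r.
Proof.
move=> ar; rewrite nrm_half.
have := xr; have := nrmD x (a * a); have := nrmM a a.
have : nrm a * nrm a <= r * 1 by apply: ler_pM; rewrite ?nrm_ge0// (le_trans ar)// ltW.
by move=> *; lra.
Qed.

Let y_le n : nrm (y n) <= r.
Proof. by elim: n => [|n ih]; [rewrite nrm0 ltW|exact: step_le]. Qed.

Let step_lip a b : nrm a <= r -> nrm b <= r ->
  nrm (step a - step b) <= r * nrm (a - b).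
Proof.
move=> ar br; rewrite -scalerBr nrm_half opprD addrACA subrr add0r.
have -> : a * a - b * b = a * (a - b) + (a - b) * b.
  by rewrite mulrBr mulrBl addrA subrK.
have := nrmD (a * (a - b)) ((a - b) * b).
have := nrmM a (a - b); have := nrmM (a - b) b.
have : nrm a * nrm (a - b) <= r * nrm (a - b) by rewrite ler_wpM2r ?nrm_ge0.
have : nrm (a - b) * nrm b <= nrm (a - b) * r by rewrite ler_wpM2l ?nrm_ge0.
by move=> *; lra.
Qed.

Let y_dist n m : nrm (y (n + m) - y n) <= r ^+ n.
Proof.
elim: n => [|n ih]; first by rewrite subr0 expr0 (le_trans (y_le _))// ltW.
rewrite exprS; apply: le_trans (step_lip (y_le _) (y_le _)) _.
by rewrite ler_wpM2l// ltW.
Qed.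

Let y_cvg : exists l : A, y @ \oo --> l.
Proof.
have [||l Hl] := @complete_approx R A (fun e a => exists2 n, a = y n & r ^+ n <= e).
- move=> e e0; have [|n rn] := @exprn_small R r e _ e0; first by rewrite ltW.
  by exists (y n), n => //; exact: ltW.
- move=> e d _ _ [n -> ne] [m -> md].
  have [nm|mn] := leqP n m.
    rewrite nrmBC -(subnKC nm) (le_trans (y_dist _ _))// (le_trans ne)//.
    by rewrite lerDl (le_trans _ md)// exprn_ge0// ltW.
  rewrite -(subnKC (ltnW mn)) (le_trans (y_dist _ _))// (le_trans md)//.
  by rewrite lerDr (le_trans _ ne)// exprn_ge0// ltW.
exists l => S /nbhs_nrm[e e0 He].
have [|N rN] := @exprn_small R r e _ e0; first by rewrite ltW.
exists N => // n /= Nn; apply: He; apply: le_lt_trans (Hl (r ^+ n) _ _ _) _.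
- by rewrite exprn_gt0.
- by exists n.
by apply: le_lt_trans rN; apply: ler_wiXn2l => //; exact: ltW.
Qed.

(** The binomial square root of [1 - x], found as a fixed point of the
    contraction [y |-> (x + y ^ 2) / 2] of the ball of radius [r]; as a limit of
    polynomials in [x] it inherits the symmetries of [x]. *)
Lemma sqrt_one_minus : star x = x ->
  exists l, [/\ star l = l, (forall z, z * x = x * z -> z * l = l * z) &
    (1 - l) * (1 - l) = 1 - x].
Proof.
move=> sx; have [l yl] := y_cvg; exists l.
have uniq (f : nat -> A) (a b : A) : f @ \oo --> a -> f @ \oo --> b -> a = b.
  by apply: norm_cvg_unique.
split.
- apply: (uniq (fun n => star (y n))).
    by apply: continuous_cvg => //; exact: star_continuous.
  rewrite [X in X @ _](_ : _ = y)//; apply/funext => n.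
  elim: n => [|n ih]; first exact: star0.
  rewrite [y n.+1]/(step (y n)) /step starZ starD starM sx ih.
  by rewrite rmorphV ?unitfE ?pnatr_eq0// rmorph_nat.
- move=> z zx; apply: (uniq (fun n => z * y n)).
    by apply: cstar_cvgM => //; exact: cvg_cst.
  rewrite [X in X @ _](_ : _ = (fun n => y n * z)).
    by apply: cstar_cvgM => //; exact: cvg_cst.
  apply/funext => n; elim: n => [|n ih]; first by rewrite mulr0 mul0r.
  rewrite [y n.+1]/(step (y n)) /step -scalerAr -scalerAl mulrDr mulrDl zx.
  by rewrite mulrA ih -mulrA ih mulrA.
have : l = step l.
  apply: (uniq (fun n => y n.+1)); first by rewrite (cvg_shiftS y).
  by apply: cvgZ; [exact: cvg_cst|]; apply: cvgD; [exact: cvg_cst|exact: cstar_cvgM].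
move=> /mulC2V e; have -> : x = l + l - l * l by rewrite -e addrK.
by rewrite mulrBr mulr1 mulrBl mul1r !opprD !opprK !addrA.
Qed.

End square_root.

Section contractive.
Context (R : realType).

(** The unitary is [h + 'i k], where [k] is the square root of [1 - h ^ 2] and
    commutes with [h]. *)
Lemma selfadjoint_unitary (A : cstarAlgType R) (h : A) :
  star h = h -> nrm h < 1 -> exists2 u, unitary u & h = 2^-1 *: (u + star u).
Proof.
move=> sh h1; have sh2 : star (h * h) = h * h by rewrite starM sh.
have [r [r0 r1 hr]] : exists r, [/\ 0 < r, r < 1 & nrm (h * h) <= r].
  exists ((1 + nrm h) / 2); have := nrm_ge0 h; have := nrmM h h.
  have : nrm h * nrm h <= nrm h * 1 by rewrite ler_wpM2l ?nrm_ge0// ltW.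
  by move=> ? ? ?; split; lra.
have [l [sl lh ll]] := sqrt_one_minus r0 r1 hr sh2.
pose k := 1 - l.
have sk : star k = k by rewrite /k starB star1 sl.
have hk : h * k = k * h.
  by rewrite /k mulrBr mulrBl mulr1 mul1r lh// mulrA.
have kk : k * k = 1 - h * h by [].
have prod (c d : R[i]) : c * d = 1 -> c + d = 0 ->
    (h + c *: k) * (h + d *: k) = 1.
  move=> cd1 cd0; rewrite mulrDl !mulrDr -!scalerAl -!scalerAr scalerA cd1.
  rewrite scale1r -hk kk addrA -(addrA (h * h)) -scalerDl.
  by rewrite [d + c]addrC cd0 scale0r addr0 addrC subrK.
have i2 : 'i * - 'i = 1 :> R[i] by rewrite mulrN -expr2 sqrCi opprK.
have su : star (h + 'i *: k) = h + (- 'i) *: k by rewrite starD starZ sh sk conjCi.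
exists (h + 'i *: k).
  by rewrite /unitary su; split; apply: prod; rewrite ?subrr ?addNr ?i2// mulrC.
rewrite su addrACA -scalerDl subrr scale0r addr0 scalerDr -scalerDl.
by rewrite -mulr2n -[_ *+ 2]mulr_natr mulVf ?scale1r// pnatr_eq0.
Qed.

Lemma starhom_unitary (A B : starAlgType R) (f : {starhom A -> B}) u :
  unitary u -> unitary (f u).
Proof.
by move=> [h1 h2]; split; rewrite -star_morph -rmorphM/= ?h1 ?h2 rmorph1.
Qed.

(** Unitaries are sent to unitaries, which have norm one, so averages of two
    unitaries are sent into the unit ball; the C*-identity reduces the general
    case to the self-adjoint element [star x * x]. *)
Lemma starhom_contractive (A B : cstarAlgType R) (f : {starhom A -> B}) x :
  nrm (f x) <= nrm x.
Proof.
have sa (h : A) : star h = h -> nrm h < 1 -> nrm (f h) <= 1.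
  move=> sh /(selfadjoint_unitary sh)[u uu ->].
  have fu := starhom_unitary f uu.
  rewrite linearZ/= nrmZ rmorphD/= star_morph.
  have -> : 2^-1 = (2^-1)%:C :> R[i] by rewrite fmorphV rmorph_nat.
  rewrite nrmc_real ger0_norm ?invr_ge0//.
  have := nrmD (f u) (star (f u)); rewrite nrm_star !(nrm_unitary fu).
  by move=> ?; lra.
have sa' (h : A) : star h = h -> nrm (f h) <= nrm h.
  move=> sh; apply/ler_addgt0Pr => e e0.
  have c0 : 0 < nrm h + e by rewrite ltr_wpDl ?nrm_ge0.
  have := sa ((nrm h + e)^-1%:C *: h).
  rewrite starZ sh linearZ/= !nrmZ nrmc_real gtr0_norm ?invr_gt0//.
  rewrite conj_Creal ?complex_real//.
  rewrite -ltr_pdivlMl ?invr_gt0// invrK mulr1 ltrDl => /(_ erefl e0).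
  by rewrite -ler_pdivlMl ?invr_gt0// invrK mulr1.
rewrite -(@ler_pXn2r _ 2) ?nnegrE ?nrm_ge0// -!nrm_starM -star_morph -rmorphM.
by apply: sa'; rewrite starM starK.
Qed.

End contractive.

(** * Fourier coefficients and extraction of roots *)

Section roots_of_unity.
Context (R : realType).

Lemma unimodular_mul_conj (z : R[i]) : nrm (z : R[i]) = 1 -> z * z^* = 1.
Proof. by move=> z1; rewrite -normCK normE z1 expr1n. Qed.

Lemma unimodularM (z w : R[i]) :
  nrm (z : R[i]) = 1 -> nrm (w : R[i]) = 1 -> nrm (z * w : R[i]) = 1.
Proof. by move=> z1 w1; rewrite nrmcM z1 w1 mulr1. Qed.

Lemma unimodularX (z : R[i]) n : nrm (z : R[i]) = 1 -> nrm (z ^+ n : R[i]) = 1.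
Proof. by move=> z1; rewrite nrmcX z1 expr1n. Qed.

Lemma primitive_root_exists n : (0 < n)%N ->
  exists2 w : R[i], n.-primitive_root w & nrm (w : R[i]) = 1.
Proof.
move=> n0; pose p : {poly R[i]} := 'X^n - 1.
have [r Dp] := closed_field_poly_normal p.
rewrite (monicP _) ?monicXnsubC// scale1r in Dp.
have rn1 : all n.-unity_root r by apply/allP => z; rewrite -root_prod_XsubC -Dp.
have sz_r : (n < (size r).+1)%N.
  by rewrite -(size_prod_XsubC r id) -Dp size_XnsubC.
have [|w _ prw] := hasP (has_prim_root n0 rn1 _ sz_r).
  by rewrite -separable_prod_XsubC -Dp separable_Xn_sub_1// pnatr_eq0 -lt0n.
exists w => //; apply/eqP; rewrite -(@eqrXn2 _ n) ?nrm_ge0//.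
by rewrite -nrmcX (prim_expr_order prw) nrmc_real normr1 expr1n.
Qed.

Lemma roots_orthogonal M (w : R[i]) (i n : nat) : M.-primitive_root w ->
  nrm (w : R[i]) = 1 -> (i < M)%N -> (n < M)%N ->
  \sum_(j < M) (w ^+ j) ^+ i * ((w ^+ j) ^+ n)^* = M%:R *+ (i == n).
Proof.
move=> prw w1 iM nM; pose v := w ^+ i * (w ^+ n)^*.
have -> : \sum_(j < M) (w ^+ j) ^+ i * ((w ^+ j) ^+ n)^* = \sum_(j < M) v ^+ j.
  apply: eq_bigr => j _; rewrite exprMn -rmorphXn.
  by rewrite -!exprM mulnC [(j * n)%N]mulnC.
have [ein|ni] := eqVneq i n.
  rewrite (eq_bigr (fun=> 1)); last first.
    by move=> j _; rewrite /v ein unimodular_mul_conj ?expr1n// unimodularX.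
  by rewrite sumr_const card_ord mulr1n.
have v1 : v - 1 != 0.
  rewrite subr_eq0; apply: contra ni => /eqP v1.
  have : w ^+ i == w ^+ n.
    rewrite -[w ^+ i]mulr1 -(unimodular_mul_conj (unimodularX n w1)).
    by rewrite mulrCA -/v v1 mulr1.
  by rewrite (eq_prim_root_expr prw) !modn_small.
apply: (mulfI v1); rewrite -subrX1 mulr0 exprMn -rmorphXn -!exprM.
by rewrite ![(_ * M)%N]mulnC !exprM (prim_expr_order prw) !expr1n rmorph1 mulr1 subrr.
Qed.

(** The discrete Fourier transform recovers a coefficient as an average of
    values, so it cannot exceed all the values in norm. *)
Lemma coef_bound (A : cstarAlgType R) M (y : nat -> A) (c : R) :
    (forall z : R[i], nrm (z : R[i]) = 1 ->
      nrm (\sum_(i < M) z ^+ i *: y i) <= c) ->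
  forall n, (n < M)%N -> nrm (y n) <= c.
Proof.
move=> H n nM; have M0 : (0 < M)%N by apply: leq_ltn_trans nM.
have [w prw w1] := primitive_root_exists M0.
have E : \sum_(j < M) ((w ^+ j) ^+ n)^* *: (\sum_(i < M) (w ^+ j) ^+ i *: y i) =
    (M%:R%:C : R[i]) *: y n.
  under eq_bigr do rewrite scaler_sumr.
  rewrite exchange_big/= (bigD1 (Ordinal nM))//= [X in _ + X]big1 ?addr0; last first.
    move=> i ni; under eq_bigr do rewrite scalerA mulrC.
    rewrite -scaler_suml roots_orthogonal//.
    by rewrite -[i == n :> nat]/(i == Ordinal nM) (negbTE ni) scale0r.
  under eq_bigr do rewrite scalerA mulrC.
  by rewrite -scaler_suml roots_orthogonal// eqxx rmorph_nat.
have M0' : 0 < M%:R :> R by rewrite ltr0n.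
rewrite -(ler_pM2l M0').
have -> : M%:R * nrm (y n) = nrm ((M%:R%:C : R[i]) *: y n).
  by rewrite nrmZ nrmc_real ger0_norm// ltW.
rewrite -E; apply: le_trans (nrm_sum _ _ _) _.
apply: (@le_trans _ _ (\sum_(j < M) c)); last first.
  by rewrite sumr_const card_ord mulr_natl.
apply: ler_sum => j _; rewrite nrmZ nrmc_conj unimodularX ?unimodularX// mul1r.
by apply: H; rewrite unimodularX.
Qed.

End roots_of_unity.

Section power_trick.
Context (R : realType).

(** A constant and a linear factor disappear when roots are taken: a power
    [(a / s) ^ (2 ^ k)] with [s < a] grows at least quadratically in [2 ^ k]. *)
Lemma power_trick (a s C : R) : 0 <= a -> 0 <= s ->
  (forall k, a ^+ (2 ^ k) <= C * (2 ^ k)%:R * s ^+ (2 ^ k)) -> a <= s.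
Proof.
move=> a0 s0 H; rewrite leNgt; apply/negP => sa.
have [s00|s1] := eqVneq s 0.
  by have := H 0; rewrite expn0 !expr1 s00 mulr0 leNgt -s00 sa.
have {s1}s1 : 0 < s by rewrite lt_def s1.
pose d := a / s - 1.
have d0 : 0 < d by rewrite subr_gt0 ltr_pdivlMr// mul1r.
have bern n : 1 + n%:R * d <= (a / s) ^+ n.
  elim: n => [|n ih]; first by rewrite mul0r addr0 expr0.
  have as0 : 0 <= a / s by rewrite divr_ge0.
  rewrite exprS; apply: (le_trans _ (ler_wpM2l as0 ih)).
  have -> : a / s = 1 + d by rewrite /d addrC subrK.
  rewrite -natr1; have : 0 <= n%:R * d * d by rewrite !mulr_ge0// ltW.
  by move=> ?; lra.
have {}H k : (2 ^ k)%:R * d ^+ 2 <= 2 * C.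
  have N0 : 0 < (2 ^ k)%:R :> R by rewrite ltr0n expn_gt0.
  have := H k.+1; rewrite -ler_pdivrMr ?exprn_gt0// -expr_div_n.
  rewrite expnSr exprM natrM => h.
  have h2 : ((2 ^ k)%:R * d) ^+ 2 <= ((a / s) ^+ (2 ^ k)) ^+ 2.
    rewrite ler_pXn2r ?nnegrE//; last 2 first.
    - by rewrite mulr_ge0// ltW.
    - by rewrite exprn_ge0// divr_ge0.
    by have := bern (2 ^ k)%N; move=> ?; lra.
  rewrite -(ler_pM2l N0); have := le_trans h2 h.
  by rewrite exprMn; set N := _%:R; move=> ?; rewrite !expr2; lra.
have [m _ Hm] : exists2 m : nat, (0 < m)%N & 2 * C / d ^+ 2 < m%:R.
  exists (Num.truncn `|2 * C / d ^+ 2|).+1 => //.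
  by apply: le_lt_trans (ler_norm _) _; exact: truncnS_gt.
have : (2 ^ m)%:R * d ^+ 2 <= m%:R * d ^+ 2.
  by apply: le_trans (H m) _; rewrite -ler_pdivrMr ?exprn_gt0// ltW.
by rewrite ler_pM2r ?exprn_gt0// ler_nat leqNgt ltn_expl.
Qed.

(** By the C*-identity, squaring is multiplicative on norms of normal
    elements, and powers of normal elements are normal. *)
Lemma nrm_normalX (A : cstarAlgType R) (x : A) k : star x * x = x * star x ->
  nrm (x ^+ (2 ^ k)) = nrm x ^+ (2 ^ k).
Proof.
elim: k x => [|k ih] x nx; first by rewrite !expr1.
have n2 : star (x ^+ 2) * x ^+ 2 = star (star x * x) * (star x * x).
  rewrite !expr2 !starM starK -!mulrA; congr (_ * _).
  by rewrite !mulrA nx.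
rewrite expnS exprM ih; last first.
  have -> : star (x ^+ 2) = star x ^+ 2 by rewrite !expr2 starM.
  exact/commrX/commr_sym/commrX/commr_sym.
rewrite exprM; congr (_ ^+ _); apply/eqP.
by rewrite -(@eqrXn2 _ 2) ?nrm_ge0 ?exprn_ge0 ?nrm_ge0// -(nrm_starM (x ^+ 2)) n2 !nrm_starM.
Qed.

End power_trick.

(** * Polynomials in a unitary *)

Section polynomials_in_a_unitary.
Context (R : realType) (A : cstarAlgType R) (V : A).
Hypothesis uV : unitary V.

Lemma unitaryX n : unitary (V ^+ n).
Proof.
elim: n => [|n [ih1 ih2]]; first by rewrite expr0; split; rewrite star1 mul1r.
case: uV => v1 v2; split; rewrite exprS starM.
  by rewrite -mulrA (mulrA (star V)) v1 mul1r.
by rewrite -mulrA (mulrA _ _ (star V)) ih2 mul1r.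
Qed.

Lemma horner_algE (q : {poly R[i]}) :
  horner_alg V q = \sum_(i < size q) q`_i *: V ^+ i.
Proof.
rewrite -[X in horner_alg V X]coefK poly_def linear_sum/=.
by apply: eq_bigr => i _; rewrite linearZ/= rmorphXn/= horner_algX mulr_algl.
Qed.

Lemma comm_horner_alg (q : {poly R[i]}) z : z * V = V * z ->
  z * horner_alg V q = horner_alg V q * z.
Proof.
move=> zV; rewrite horner_algE mulr_sumr mulr_suml; apply: eq_bigr => i _.
rewrite -scalerAr -scalerAl; congr (_ *: _); exact: (commrX i zV).
Qed.

Lemma normal_horner_alg (q : {poly R[i]}) :
  star (horner_alg V q) * horner_alg V q = horner_alg V q * star (horner_alg V q).
Proof.
apply: comm_horner_alg.
have /(congr1 star) : star V * horner_alg V q = horner_alg V q * star V.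
  by apply: comm_horner_alg; case: uV => -> ->.
by rewrite !starM starK.
Qed.

Lemma poly_coef_bound (q : {poly R[i]}) (c : R) :
    (forall z : R[i], nrm (z : R[i]) = 1 -> nrm (q.[z] : R[i]) <= c) ->
  forall i, (i < size q)%N -> nrm (q`_i : R[i]) <= c.
Proof.
move=> H i iq; apply: (@coef_bound R R[i] (size q) (fun i => q`_i) c) => // z z1.
rewrite (_ : \sum_(i < size q) _ = q.[z]); first exact: H.
by rewrite horner_coef; apply: eq_bigr => j _; rewrite mulrC.
Qed.

(** Bounding the coefficients gives the estimate up to the factor [size q];
    applied to the powers of [q], it gives the estimate itself. *)
Lemma horner_alg_bound (q : {poly R[i]}) (c : R) :
    (forall z : R[i], nrm (z : R[i]) = 1 -> nrm (q.[z] : R[i]) <= c) ->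
  nrm (horner_alg V q) <= c.
Proof.
have crude (p : {poly R[i]}) (d : R) :
    (forall z : R[i], nrm (z : R[i]) = 1 -> nrm (p.[z] : R[i]) <= d) ->
    nrm (horner_alg V p) <= (size p)%:R * d.
  move=> H; rewrite horner_algE (le_trans (nrm_sum _ _ _))//.
  have -> : (size p)%:R * d = \sum_(i < size p) d.
    by rewrite sumr_const card_ord mulr_natl.
  apply: ler_sum => i _; rewrite nrmZ (nrm_unitary (unitaryX i)) mulr1.
  exact: poly_coef_bound.
move=> H.
have c0 : 0 <= c.
  apply: le_trans (H 1 _); first exact: nrm_ge0.
  by rewrite nrmc_real normr1.
apply: (@power_trick R _ _ (size q).+1%:R) => // [|k]; first exact: nrm_ge0.
rewrite -nrm_normalX; last exact: normal_horner_alg.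
rewrite -rmorphXn/=; apply: (le_trans (crude _ (c ^+ (2 ^ k)) _)) => [z z1|].
  by rewrite horner_exp nrmcX ler_pXn2r ?nnegrE ?nrm_ge0 ?H// expn_gt0.
rewrite ler_wpM2r ?exprn_ge0// -natrM ler_nat.
apply: leq_trans (size_poly_exp_leq _ _) _.
have : (0 < 2 ^ k)%N by rewrite expn_gt0.
by move: (2 ^ k)%N => N N0; case: (size q) => [|s] /=; nia.
Qed.

End polynomials_in_a_unitary.

Section trigonometric_polynomials.
Context (R : realType) (A : cstarAlgType R) (V : A).
Hypothesis uV : unitary V.
Local Notation C := R[i].

(** The trigonometric polynomials [z ^ (- n) * q z], paired with their values
    at [V]: pairing turns the compatibility of both evaluations with algebraic
    operations into closure properties of one relation. *)
Definition trig (g : C -> C) (a : A) := exists n (q : {poly C}),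
  a = star V ^+ n * horner_alg V q /\
  forall z : C, nrm (z : C) = 1 -> g z = z^* ^+ n * q.[z].

Let starVK n : star V ^+ n * V ^+ n = 1.
Proof.
elim: n => [|n ih]; first by rewrite !expr0 mulr1.
by rewrite exprSr exprS -mulrA (mulrA (star V)) uV.1 mul1r.
Qed.

Let comm_starV n (q : {poly C}) :
  star V ^+ n * horner_alg V q = horner_alg V q * star V ^+ n.
Proof.
apply: comm_horner_alg; apply/commr_sym/commrX.
by rewrite /GRing.comm uV.1 uV.2.
Qed.

Lemma trig_ext g h a : (forall z : C, nrm (z : C) = 1 -> g z = h z) ->
  trig g a -> trig h a.
Proof. by move=> gh [n [q [-> H]]]; exists n, q; split => // z z1; rewrite -gh ?H. Qed.

(** Raising the power of [star V] brings two trigonometric polynomials to a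
    common denominator. *)
Lemma trig_shift g n (q : {poly C}) m :
    (forall z : C, nrm (z : C) = 1 -> g z = z^* ^+ n * q.[z]) ->
  star V ^+ n * horner_alg V q = star V ^+ (m + n) * horner_alg V ('X^m * q) /\
  forall z : C, nrm (z : C) = 1 -> g z = z^* ^+ (m + n) * ('X^m * q).[z].
Proof.
move=> H; split.
  rewrite rmorphM/= rmorphXn/= horner_algX addnC exprD -mulrA.
  by congr (_ * _); rewrite mulrA starVK mul1r.
move=> z z1; rewrite H// hornerM hornerXn addnC exprD -mulrA; congr (_ * _).
by rewrite mulrA -exprMn mulrC [_ * z]mulrC unimodular_mul_conj// expr1n mulr1.
Qed.

Lemma trig_const (c : C) : trig (fun=> c) (c *: 1).
Proof.
exists 0%N, c%:P; split; last by move=> z _; rewrite hornerC expr0 mul1r.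
by rewrite horner_algC expr0 mul1r.
Qed.

Lemma trig_id : trig id V.
Proof.
exists 0%N, 'X; split; last by move=> z _; rewrite hornerX expr0 mul1r.
by rewrite horner_algX expr0 mul1r.
Qed.

Lemma trigD g h a b : trig g a -> trig h b -> trig (fun z => g z + h z) (a + b).
Proof.
move=> [n [q [-> Hq]]] [m [p [-> Hp]]].
have [-> Hq'] := trig_shift m Hq; have [-> Hp'] := trig_shift n Hp.
exists (m + n)%N, ('X^m * q + 'X^n * p); split.
  by rewrite rmorphD/= mulrDr addnC.
by move=> z z1; rewrite hornerD mulrDr Hq'// Hp'// [(n + m)%N]addnC.
Qed.

Lemma trigM g h a b : trig g a -> trig h b -> trig (fun z => g z * h z) (a * b).
Proof.
move=> [n [q [-> Hq]]] [m [p [-> Hp]]]; exists (n + m)%N, (q * p); split.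
  rewrite rmorphM/= exprD -!mulrA; congr (_ * _).
  by rewrite !mulrA comm_starV.
by move=> z z1; rewrite hornerM Hq// Hp// exprD mulrACA.
Qed.

Lemma trig_sum (I : Type) (r : seq I) (g : I -> C -> C) (a : I -> A) :
  (forall i, trig (g i) (a i)) ->
  trig (fun z => \sum_(i <- r) g i z) (\sum_(i <- r) a i).
Proof.
move=> H; elim: r => [|i r ih].
  rewrite big_nil; apply: (@trig_ext (fun=> 0)); first by move=> z; rewrite big_nil.
  by have := trig_const 0; rewrite scale0r.
rewrite big_cons; apply: trig_ext (trigD (H i) ih).
by move=> z _; rewrite big_cons.
Qed.

Lemma trigX g a n : trig g a -> trig (fun z => g z ^+ n) (a ^+ n).
Proof.
move=> H; elim: n => [|n ih].
  by have := trig_const 1; rewrite scale1r expr0; apply: trig_ext.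
by rewrite exprS; apply: trig_ext (trigM H ih) => z _; rewrite exprS.
Qed.

Lemma trig_star g a : trig g a -> trig (fun z => (g z)^*) (star a).
Proof.
have trigV : trig (fun z => z^*) (star V).
  exists 1%N, 1; split; first by rewrite rmorph1 expr1 mulr1.
  by move=> z _; rewrite hornerC expr1 mulr1.
move=> [n [q [-> Hq]]]; rewrite starM horner_algE.
have -> : star (\sum_(i < size q) q`_i *: V ^+ i) =
    \sum_(i < size q) ((q`_i)^* *: 1) * star V ^+ i.
  rewrite (big_morph _ (@starD _ A) (star0 A)); apply: eq_bigr => i _.
  rewrite starZ -scalerAl mul1r; congr (_ *: _).
  by elim: (nat_of_ord i) => [|k ih]; rewrite ?star1// exprS starM ih -exprSr.
have -> : star (star V ^+ n) = V ^+ n.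
  by elim: n {Hq} => [|k ih]; rewrite ?star1// exprS starM ih starK -exprSr.
have tmon (i : 'I_(size q)) :
    trig (fun z => (q`_i)^* * z^* ^+ i) ((q`_i)^* *: 1 * star V ^+ i).
  by apply: trigM; [exact: trig_const|exact: trigX].
have := trigM (trig_sum (index_enum _) tmon) (trigX n trig_id).
apply: trig_ext => z z1.
rewrite Hq// rmorphM/= -rmorphXn/= conjCK mulrC horner_coef rmorph_sum/=; congr (_ * _).
by apply: eq_bigr => i _; rewrite rmorphM/= rmorphXn.
Qed.

Lemma trig_bound g a (c : R) : trig g a ->
  (forall z : C, nrm (z : C) = 1 -> nrm (g z : C) <= c) -> nrm a <= c.
Proof.
move=> [n [q [-> Hq]]] H.
have uVs : unitary (star V ^+ n).
  by apply: unitaryX; case: uV => h1 h2; split; rewrite starK.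
rewrite (nrm_unitaryl _ uVs); apply: horner_alg_bound => // z z1.
by have := H z z1; rewrite Hq// nrmcM nrmcX nrmc_conj z1 expr1n mul1r.
Qed.

Lemma trig_bounded g a : trig g a ->
  exists2 K : R, 0 <= K & forall z : C, nrm (z : C) = 1 -> nrm (g z : C) <= K.
Proof.
move=> [n [q [_ Hq]]]; exists (\sum_(i < size q) nrm (q`_i : C)).
  by apply: sumr_ge0 => i _; exact: nrm_ge0.
move=> z z1; rewrite Hq// nrmcM nrmcX nrmc_conj z1 expr1n mul1r horner_coef.
apply: le_trans (@nrm_sum R R[i] _ _ _ _) _; apply: ler_sum => i _.
by rewrite nrmcM nrmcX z1 expr1n mulr1.
Qed.

End trigonometric_polynomials.

(** * The continuous functional calculus of a unitary *)

Section functional_calculus.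
Context (R : realType) (A : cstarAlgType R) (V : A).
Hypothesis uV : unitary V.
Local Notation C := R[i].

(** The relation between a function [g] and the value [g V] of the continuous
    functional calculus, obtained by completing [trig]. *)
Definition fcalc (g : C -> C) (a : A) := forall e : R, 0 < e ->
  exists p b, [/\ trig V p b,
    forall z : C, nrm (z : C) = 1 -> nrm (g z - p z : C) <= e & nrm (a - b) <= e].

Lemma fcalc_ext g h a : (forall z : C, nrm (z : C) = 1 -> g z = h z) ->
  fcalc g a -> fcalc h a.
Proof.
move=> gh H e e0; have [p [b [pb gp ab]]] := H e e0; exists p, b; split => //.
by move=> z z1; rewrite -gh// gp.
Qed.

Lemma fcalc_trig g a : trig V g a -> fcalc g a.
Proof.
move=> ga e e0; exists g, a; split => // [z z1|]; last by rewrite subrr nrm0 ltW.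
by rewrite subrr nrm0 ltW.
Qed.

(** The sharp estimate for trigonometric polynomials passes to the limit; it
    makes the calculus single-valued and contractive. *)
Lemma fcalc_bound g h a b (c : R) : fcalc g a -> fcalc h b ->
  (forall z : C, nrm (z : C) = 1 -> nrm (g z - h z : C) <= c) -> nrm (a - b) <= c.
Proof.
move=> ga hb gh; apply/ler_addgt0Pr => e e0.
have e4 : 0 < e / 4 by rewrite divr_gt0.
have [p [a' [pa gp aa]]] := ga _ e4; have [q [b' [qb hq bb]]] := hb _ e4.
have H : nrm (a' + (- 1) *: 1 * b') <= c + e / 2.
  apply: (trig_bound uV (trigD uV pa (trigM uV (trig_const V (- 1)) qb))) => z z1.
  have -> : p z + -1 * q z = (p z - g z) + ((g z - h z) + (h z - q z)) by ring.
  apply: le_trans (nrmcD _ _) _.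
  have := nrmcD (g z - h z) (h z - q z); have := gp z z1; have := hq z z1.
  have := gh z z1; rewrite [nrm (p z - g z : C)]nrmBC; move=> *; lra.
rewrite -scalerAl mul1r scaleN1r in H.
apply: le_trans (nrmB_trans a' _ _) _; have := nrmB_trans b' a' b.
by rewrite [nrm (b' - b)]nrmBC; move=> *; lra.
Qed.

Lemma fcalc_uniq g a b : fcalc g a -> fcalc g b -> a = b.
Proof.
move=> ga gb; apply/eqP; rewrite -subr_eq0; apply/eqP; apply: nrm_eq0.
by apply: (fcalc_bound ga gb) => z z1; rewrite subrr nrm0.
Qed.

Lemma fcalcD g h a b : fcalc g a -> fcalc h b ->
  fcalc (fun z => g z + h z) (a + b).
Proof.
move=> ga hb e e0; have e2 : 0 < e / 2 by rewrite divr_gt0.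
have [p [a' [pa gp aa]]] := ga _ e2; have [q [b' [qb hq bb]]] := hb _ e2.
exists (fun z => p z + q z), (a' + b'); split; first exact: trigD.
  move=> z z1; have -> : g z + h z - (p z + q z) = (g z - p z) + (h z - q z) by ring.
  apply: le_trans (nrmcD _ _) _; rewrite (splitr e).
  by apply: lerD; [exact: gp|exact: hq].
rewrite opprD addrACA (le_trans (nrmD _ _))// (splitr e).
exact: lerD.
Qed.

Lemma fcalc_bounded g a : fcalc g a -> exists2 K : R, 0 <= K &
  nrm a <= K /\ forall z : C, nrm (z : C) = 1 -> nrm (g z : C) <= K.
Proof.
move=> /(_ 1 ltr01)[p [b [pb gp ab]]]; have [K K0 pK] := trig_bounded pb.
exists (K + nrm b + 1); first by rewrite !addr_ge0// nrm_ge0.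
split.
  rewrite -[a](subrK b); have := nrmD (a - b) b; move=> *; lra.
move=> z z1; rewrite -[g z](subrK (p z)); have := nrmcD (g z - p z) (p z).
have := gp z z1; have := pK z z1; have := nrm_ge0 b; move=> *; lra.
Qed.

Lemma fcalcM g h a b : fcalc g a -> fcalc h b ->
  fcalc (fun z => g z * h z) (a * b).
Proof.
move=> ga hb e e0.
have [K K0 [aK gK]] := fcalc_bounded ga; have [L L0 [bL hL]] := fcalc_bounded hb.
pose d := Num.min 1 (e / (K + L + 1)).
have KL : 0 < K + L + 1 by rewrite ltr_wpDl// addr_ge0.
have d0 : 0 < d by rewrite lt_min ltr01 divr_gt0.
have d1 : d <= 1 by rewrite ge_min lexx.
have de : d * (K + L + 1) <= e by rewrite -ler_pdivlMr// ge_min lexx orbT.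
have [p [a' [pa gp aa]]] := ga _ d0; have [q [b' [qb hq bb]]] := hb _ d0.
have est (x y u v : R) : 0 <= x -> x <= K -> 0 <= v -> v <= d -> 0 <= u -> u <= d ->
    0 <= y -> y <= L + d -> x * v + u * y <= e.
  move=> x0 xK v0 vd u0 ud y0 yL; apply: le_trans de.
  have := ler_pM x0 v0 xK vd; have := ler_pM u0 y0 ud yL.
  have : d * d <= d * 1 by rewrite ler_wpM2l// ltW.
  by rewrite !mulrDr mulr1 [d * K]mulrC; move=> *; lra.
exists (fun z => p z * q z), (a' * b'); split; first exact: trigM.
  move=> z z1.
  have -> : g z * h z - p z * q z = g z * (h z - q z) + (g z - p z) * q z by ring.
  apply: le_trans (nrmcD _ _) _; rewrite !nrmcM.
  apply: est; rewrite ?nrm_ge0 ?gK ?gp ?hq//.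
  rewrite -[q z](subrK (h z)) (le_trans (nrmcD _ _))// addrC lerD ?hL//.
  by rewrite nrmBC hq.
have -> : a * b - a' * b' = a * (b - b') + (a - a') * b'.
  by rewrite mulrBr mulrBl addrA subrK.
apply: le_trans (nrmD _ _) _.
apply: le_trans (lerD (nrmM _ _) (nrmM _ _)) _.
apply: est; rewrite ?nrm_ge0//.
rewrite -[b'](subrK b) (le_trans (nrmD _ _))// addrC lerD//.
by rewrite nrmBC.
Qed.

Lemma fcalc_star g a : fcalc g a -> fcalc (fun z => (g z)^*) (star a).
Proof.
move=> ga e e0; have [p [b [pb gp ab]]] := ga _ e0.
exists (fun z => (p z)^*), (star b); split; first exact: trig_star.
  by move=> z z1; rewrite -rmorphB/= nrmc_conj gp.
by rewrite -starB nrm_star.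
Qed.

End functional_calculus.

Section kernel.
Context (R : realType).
Local Notation C := R[i].

(** The parallelogram identity on the unit circle. *)
Lemma kernelE (w : C) : nrm (w : C) = 1 ->
  ((1 + w) * (1 + w)^*) = ((4 - nrm (1 - w : C) ^+ 2)%:C : C).
Proof.
move=> w1; rewrite rmorphB rmorphXn/= -normE normCK.
have -> : (1 - w)^* = 1 - w^* :> C by rewrite rmorphB rmorph1.
have -> : (1 + w)^* = 1 + w^* :> C by rewrite rmorphD rmorph1.
have ww := unimodular_mul_conj w1.
have -> : (4 : R)%:C = 4 :> C by rewrite rmorph_nat.
by rewrite !mulrDr !mulrDl !mulr1 !mul1r !mulrN !mulNr ww; ring.
Qed.

(** The powers of [w ^ j] occurring in the expansion of the [n]-th power of the
    kernel range between [- n] and [n], so that among them the average over the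
    roots of unity of order [2 n + 1] keeps only the constant term. *)
Lemma kernel_sum n (w z : C) : (n.*2.+1).-primitive_root w ->
    nrm (w : C) = 1 -> nrm (z : C) = 1 ->
  \sum_(j < n.*2.+1) ((1 + z * (w ^+ j)^*) * (1 + z * (w ^+ j)^*)^*) ^+ n =
    (n.*2.+1 * 'C(n.*2, n))%:R.
Proof.
move=> prw w1 z1.
have E (j : 'I_n.*2.+1) :
    ((1 + z * (w ^+ j)^*) * (1 + z * (w ^+ j)^*)^*) ^+ n =
    \sum_(k < n.*2.+1) (z ^+ k * z^* ^+ n *+ 'C(n.*2, k)) *
      ((w ^+ j) ^+ n * ((w ^+ j) ^+ k)^*).
  set u := (w ^+ j)^*.
  have zu : (z * u) * (z * u)^* = 1.
    by rewrite unimodular_mul_conj// unimodularM// nrmc_conj unimodularX.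
  have -> : (1 + z * u) * (1 + z * u)^* = (1 + z * u) ^+ 2 * (z * u)^*.
    rewrite rmorphD rmorph1 expr2 -mulrA; congr (_ * _).
    by rewrite mulrDl mul1r zu addrC.
  rewrite exprMn -[_ ^+ 2 ^+ n]exprM mul2n exprDn mulr_suml; apply: eq_bigr => k _.
  rewrite expr1n mul1r mulrnAl [RHS]mulrnAl; congr (_ *+ _).
  rewrite [(z * u)^*]rmorphM/= !exprMn /u conjCK [X in _ = _ * (_ * X)]rmorphXn/=.
  by ring.
under eq_bigr do rewrite E.
rewrite exchange_big/= (bigD1 (inord n))//= [X in _ + X]big1 ?addr0.
  rewrite -mulr_sumr roots_orthogonal ?inordK ?ltnS// -?addnn ?leq_addr//.
  rewrite eqxx mulr1n -exprMn unimodular_mul_conj// expr1n mulrC natrM.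
  by rewrite mulr_natr.
move=> k; rewrite -val_eqE/= inordK ?ltnS -?addnn ?leq_addr// => kn.
rewrite -mulr_sumr roots_orthogonal// ?addnn//; last by rewrite ltnS -addnn leq_addr.
by rewrite eq_sym (negbTE kn) mulr0.
Qed.

(** Otherwise [1 = 1 ^ (2 ^ k)] would be at most a multiple of
    [2 ^ k * r ^ (2 ^ k)] for all [k], against the extraction of roots. *)
Lemma linear_times_geometric (r e : R) : 0 <= r -> r < 1 -> 0 < e ->
  exists n, (n.*2.+1)%:R * r ^+ n <= e.
Proof.
move=> r0 r1 e0; apply: contrapT => /forallNP H.
have : 1 <= r.
  apply: (@power_trick R _ _ (3 / e)) => // k; rewrite expr1n.
  have := H (2 ^ k)%N => /negP; rewrite -ltNge => h.
  have {h} : e < 3 * (2 ^ k)%:R * r ^+ (2 ^ k).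
    apply: lt_le_trans h _; rewrite ler_wpM2r ?exprn_ge0// -natrM ler_nat.
    by have := expn_gt0 2 k; move: (2 ^ k)%N => N; lia.
  rewrite -[3 / e]mulrC -!mulrA [e^-1 * _]mulrC ler_pdivlMr// mul1r !mulrA.
  exact: ltW.
by rewrite leNgt r1.
Qed.

(** The two alternatives serve for the points near the one where the weight
    concentrates, whose values are close to [v], and for the far ones, whose
    weight is negligible. *)
Lemma weighted_average (I : finType) (k : I -> R) (x : I -> C) (v : C)
    (e t s : R) :
    (forall i, 0 <= k i) -> \sum_i k i = s -> 0 < s -> 0 <= e ->
    (forall i, nrm (x i - v : C) <= e \/ nrm (x i - v : C) * k i <= t) ->
    0 <= t -> #|I|%:R * t <= e * s ->
  nrm (v - (s^-1)%:C * \sum_i (k i)%:C * x i : C) <= e + e.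
Proof.
move=> k0 ks s0 e0 H t0 ts.
have sC : s%:C != 0 :> C by apply: contra_neq (lt0r_neq0 s0) => -[].
have -> : v - (s^-1)%:C * (\sum_i (k i)%:C * x i) =
    - ((s^-1)%:C * \sum_i (k i)%:C * (x i - v)) :> C.
  under [in RHS]eq_bigr do rewrite mulrBr.
  rewrite sumrB mulrBr -mulr_suml -rmorph_sum/= ks fmorphV mulrA mulVf// mul1r.
  by rewrite opprB.
rewrite nrmN nrmcM nrmc_real gtr0_norm ?invr_gt0// ler_pdivrMl//.
apply: le_trans (@nrm_sum R R[i] _ _ _ _) _.
apply: (@le_trans _ _ (\sum_i (k i * e + t))).
  apply: ler_sum => i _; rewrite nrmcM nrmc_real ger0_norm//.
  have := H i; have := k0 i; have := nrm_ge0 (x i - v : C) => h1 h2 [h3|h3].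
    by rewrite -[X in X <= _]addr0 lerD// ler_wpM2l.
  by rewrite -[X in X <= _]add0r lerD// 1?mulrC// mulr_ge0.
rewrite big_split/= -mulr_suml ks sumr_const mulrDr [e * s]mulrC in ts *.
by rewrite lerD// -mulr_natl.
Qed.

Context (A : cstarAlgType R) (V : A).
Hypothesis uV : unitary V.

(** Averaging [g] against the powers of [|1 + w| ^ 2], which concentrate near
    [w = 1], produces trigonometric polynomials converging to [g]. The total
    weight is the same at every point of the circle, and at least [4 ^ n]
    because of the term [w = 1], while the points with [d <= |1 - w|] have
    weight at most [(4 - d ^ 2) ^ n]. *)
Lemma trig_dense (g : C -> C) (K : R) :
    (forall z : C, nrm (z : C) = 1 -> nrm (g z : C) <= K) ->
    (forall e : R, 0 < e -> exists2 d : R, 0 < d & forall z w : C,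
      nrm (z : C) = 1 -> nrm (w : C) = 1 -> nrm (z - w : C) < d ->
      nrm (g z - g w : C) <= e) ->
  forall e : R, 0 < e -> exists p b, trig V p b /\
    forall z : C, nrm (z : C) = 1 -> nrm (g z - p z : C) <= e.
Proof.
move=> gK gU e e0.
have e2 : 0 < e / 2 by rewrite divr_gt0.
have [d0 d00 Hd0] := gU _ e2.
pose d := Num.min 1 d0.
have dgt0 : 0 < d by rewrite lt_min ltr01.
have dd0 : d <= d0 by rewrite ge_min lexx orbT.
have d1 : d <= 1 by rewrite ge_min lexx.
have d21 : d ^+ 2 <= 1 by rewrite exprn_ile1// ltW.
have d2gt0 : 0 < d ^+ 2 by rewrite exprn_gt0.
have K0 : 0 <= K.
  by apply: le_trans (nrm_ge0 _) (gK 1 _); rewrite nrmc_real normr1.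
pose r := 1 - d ^+ 2 / 4.
have [|||n Hn] := @linear_times_geometric r (e / 2 / (2 * K + 1)).
- by rewrite /r; lra.
- by rewrite /r; lra.
- by rewrite divr_gt0// ltr_wpDl// mulr_ge0.
have [w prw w1] := @primitive_root_exists R n.*2.+1 isT.
pose k z (j : 'I_n.*2.+1) : R := (4 - nrm (1 - z * (w ^+ j)^* : C) ^+ 2) ^+ n.
pose s : R := (n.*2.+1 * 'C(n.*2, n))%:R.
have zw1 z j : nrm (z : C) = 1 -> nrm (z * (w ^+ j)^* : C) = 1.
  by move=> z1; rewrite unimodularM// nrmc_conj unimodularX.
have kE z j : nrm (z : C) = 1 ->
    (k z j)%:C = ((1 + z * (w ^+ j)^*) * (1 + z * (w ^+ j)^*)^*) ^+ n.
  by move=> z1; rewrite kernelE ?zw1// -rmorphXn.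
have ks z : nrm (z : C) = 1 -> \sum_j k z j = s.
  move=> z1; apply: complexI; rewrite rmorph_sum/=.
  by under eq_bigr do rewrite kE//; rewrite (kernel_sum prw w1 z1) rmorph_nat.
have b0 z j : nrm (z : C) = 1 -> 0 <= 4 - nrm (1 - z * (w ^+ j)^* : C) ^+ 2.
  move=> z1; rewrite subr_ge0.
  have h : nrm (1 - z * (w ^+ j)^* : C) <= 2.
    apply: le_trans (@nrmD R R[i] _ _) _.
    by rewrite nrmN nrmc_real normr1 zw1.
  rewrite expr2; apply: le_trans (ler_pM _ _ h h) _; rewrite ?nrm_ge0//.
  by rewrite -natrM.
have k0 z (j : 'I_n.*2.+1) : nrm (z : C) = 1 -> 0 <= k z j.
  by move=> z1; rewrite exprn_ge0// b0.
have s4 : 4 ^+ n <= s.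
  have n1 : nrm (1 : C) = 1 by rewrite nrmc_real normr1.
  rewrite -(ks 1 n1) (bigD1 ord0)//= {1}/k expr0 rmorph1 mulr1 subrr nrm0 expr0n subr0.
  by rewrite lerDl sumr_ge0// => j _; exact: k0.
have s0 : 0 < s by apply: lt_le_trans s4; rewrite exprn_gt0.
exists (fun z => (s^-1)%:C * \sum_(j < n.*2.+1) (((1 + z * (w ^+ j)^*) *
  (1 + z * (w ^+ j)^*)^*) ^+ n) * g (w ^+ j)).
have tK (j : 'I_n.*2.+1) : exists b, trig V (fun z => ((1 + z * (w ^+ j)^*) *
    (1 + z * (w ^+ j)^*)^*) ^+ n * g (w ^+ j)) b.
  have t1 := trigD uV (trig_const V 1) (trigM uV (trig_id V) (trig_const V (w ^+ j)^*)).
  eexists; apply: (trigM uV _ (trig_const V _)); apply: (trigX uV).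
  exact: (trigM uV t1 (trig_star uV t1)).
pose b j := projT1 (cid (tK j)).
have tb j : trig V _ (b j) := projT2 (cid (tK j)).
exists ((s^-1)%:C *: 1 * \sum_j b j); split.
  apply: (trigM uV (trig_const V _)); exact: (trig_sum uV).
move=> z z1.
have -> : \sum_(j < n.*2.+1) ((1 + z * (w ^+ j)^*) * (1 + z * (w ^+ j)^*)^*) ^+ n * g (w ^+ j)
    = \sum_j (k z j)%:C * g (w ^+ j) :> C.
  by apply: eq_bigr => j _; rewrite kE.
rewrite (splitr e).
apply: (@weighted_average _ _ _ _ _ (2 * K * (4 * r) ^+ n)) => //.
- by move=> j; exact: k0.
- exact: ks.
- exact: ltW.
- move=> j; have wj1 : nrm (w ^+ j : C) = 1 by rewrite unimodularX.
  have [near|far] := ltP (nrm (w ^+ j - z : C)) d; [left|right].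
    by apply: Hd0 => //; exact: lt_le_trans near dd0.
  apply: ler_pM; rewrite ?nrm_ge0 ?k0//.
    apply: le_trans (@nrmD R R[i] _ _) _; rewrite nrmN.
    by have := gK _ z1; have := gK _ wj1; move=> *; lra.
  have dist : nrm (1 - z * (w ^+ j)^* : C) = nrm (w ^+ j - z : C).
    rewrite -[RHS]mulr1 -[X in _ = _ * X]wj1 -(nrmc_conj (w ^+ j)) -nrmcM mulrBl.
    by rewrite unimodular_mul_conj.
  have far2 : d ^+ 2 <= nrm (w ^+ j - z : C) ^+ 2.
    by rewrite ler_pXn2r ?nnegrE ?nrm_ge0// ltW.
  have := b0 z j z1; rewrite /k dist => b0'.
  by apply: lerXn2r; rewrite ?nnegrE// /r; lra.
- by rewrite !mulr_ge0// exprn_ge0// mulr_ge0// /r; lra.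
have h1 : 0 < 2 * K + 1 by rewrite ltr_wpDl// mulr_ge0.
rewrite card_ord exprMn.
have -> : n.*2.+1%:R * (2 * K * (4 ^+ n * r ^+ n)) =
    (n.*2.+1%:R * r ^+ n) * (2 * K) * 4 ^+ n by ring.
apply: ler_pM s4; rewrite ?mulr_ge0 ?exprn_ge0//.
- by rewrite /r; lra.
- move: Hn; rewrite ler_pdivlMr// mulrDr mulr1 => Hn.
  apply: le_trans Hn; rewrite lerDl mulr_ge0// exprn_ge0// /r.
  by lra.
Qed.

Lemma fcalc_exists (g : C -> C) (K : R) :
    (forall z : C, nrm (z : C) = 1 -> nrm (g z : C) <= K) ->
    (forall e : R, 0 < e -> exists2 d : R, 0 < d & forall z w : C,
      nrm (z : C) = 1 -> nrm (w : C) = 1 -> nrm (z - w : C) < d ->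
      nrm (g z - g w : C) <= e) ->
  exists a, fcalc V g a.
Proof.
move=> gK gU; have dense := trig_dense gK gU.
have [||a Ha] := @complete_approx R A (fun e b => exists2 p, trig V p b &
    forall z : C, nrm (z : C) = 1 -> nrm (g z - p z : C) <= e).
- by move=> e /dense[p [b [pb gp]]]; exists b, p.
- move=> e d a b [p pa gp] [q qb gq].
  apply: (fcalc_bound uV (fcalc_trig pa) (fcalc_trig qb)) => z z1.
  have -> : p z - q z = (p z - g z) + (g z - q z) by ring.
  apply: le_trans (nrmcD _ _) _; apply: lerD; last exact: gq.
  by rewrite nrmBC gp.
exists a => e e0; have [p [b [pb gp]]] := dense _ e0.
by exists p, b; split => //; apply: Ha => //; exists p.
Qed.

End kernel.

Section naturality.
Context (R : realType) (A : cstarAlgType R).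
Local Notation C := R[i].

Lemma unitaryZ (V : A) (z : C) : unitary V -> nrm (z : C) = 1 -> unitary (z *: V).
Proof.
move=> [v1 v2] z1; have zz := unimodular_mul_conj z1.
split; rewrite starZ -scalerAl -scalerAr scalerA ?v1 ?v2 ?zz ?scale1r//.
by rewrite mulrC zz scale1r.
Qed.

(** Morphisms are contractive and act on polynomials in [V] by acting on [V]. *)
Lemma fcalc_morph (B : cstarAlgType R) (f : {starhom A -> B}) (V : A) g a :
  fcalc V g a -> fcalc (f V) g (f a).
Proof.
move=> ga e e0; have [p [b [[n [q [-> Hq]]] gp ab]]] := ga _ e0.
exists p, (f (star V ^+ n * horner_alg V q)); split => //; last first.
  by rewrite -raddfB (le_trans (starhom_contractive _ _)).
exists n, q; split => //; rewrite rmorphM rmorphXn/= star_morph; congr (_ * _).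
rewrite !horner_algE rmorph_sum/=; apply: eq_bigr => i _.
by rewrite linearZ/= rmorphXn.
Qed.

Lemma fcalc_scale (V : A) (w : C) g a : unitary V -> nrm (w : C) = 1 ->
  fcalc (w *: V) g a -> fcalc V (fun z => g (w * z)) a.
Proof.
move=> uV w1 ga e e0; have [p [b [[n [q [-> Hq]]] gp ab]]] := ga _ e0.
exists (fun z => p (w * z)), (star (w *: V) ^+ n * horner_alg (w *: V) q).
split => //; last by move=> z z1; apply: gp; rewrite unimodularM.
have twV : trig V (fun z => w * z) (w *: V).
  by have := trigM uV (trig_const V w) (trig_id V); rewrite -scalerAl mul1r.
rewrite horner_algE.
have tmon (i : 'I_(size q)) :
    trig V (fun z => q`_i * (w * z) ^+ i) (q`_i *: (w *: V) ^+ i).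
  have := trigM uV (trig_const V q`_i) (trigX uV i twV).
  by rewrite -scalerAl mul1r.
have := trigM uV (trigX uV n (trig_star uV twV)) (trig_sum uV (index_enum _) tmon).
by apply: trig_ext => z z1; rewrite Hq ?unimodularM// horner_coef.
Qed.

(** When [V] can be rotated by automorphisms, averaging shows that the
    coefficients of [q] are bounded by the norm of [q V]; powers of [q] turn
    this into a bound of the values of [q]. In other words the spectrum of [V]
    is the whole circle. *)
Lemma fcalc_ge (V : A) g a : unitary V ->
    (forall w : C, nrm (w : C) = 1 -> exists f : {starhom A -> A}, f V = w *: V) ->
  fcalc V g a -> forall z : C, nrm (z : C) = 1 -> nrm (g z : C) <= nrm a.
Proof.
move=> uV rot.
have crude (q : {poly C}) (z : C) : nrm (z : C) = 1 ->
    nrm (q.[z] : C) <= (size q)%:R * nrm (horner_alg V q).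
  move=> z1; rewrite horner_coef (le_trans (@nrm_sum R R[i] _ _ _ _))//.
  have -> : (size q)%:R * nrm (horner_alg V q) =
      \sum_(i < size q) nrm (horner_alg V q).
    by rewrite sumr_const card_ord mulr_natl.
  apply: ler_sum => i _; rewrite nrmcM nrmcX z1 expr1n mulr1.
  have -> : nrm (q`_i : C) = nrm (q`_i *: V ^+ i).
    by rewrite nrmZ (nrm_unitary (unitaryX uV i)) mulr1.
  apply: (@coef_bound R A (size q) (fun i => q`_i *: V ^+ i)) => // w w1.
  have [f fV] := rot w w1.
  suff -> : \sum_(j < size q) w ^+ j *: (q`_j *: V ^+ j) = f (horner_alg V q).
    exact: starhom_contractive.
  rewrite horner_algE rmorph_sum/=; apply: eq_bigr => j _.
  by rewrite [in RHS]linearZ/= rmorphXn/= fV exprZn !scalerA mulrC.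
have polyge (q : {poly C}) (z : C) : nrm (z : C) = 1 ->
    nrm (q.[z] : C) <= nrm (horner_alg V q).
  move=> z1; apply: (@power_trick R _ _ (size q).+1%:R) => [||k].
  - exact: nrm_ge0.
  - exact: nrm_ge0.
  rewrite -nrmcX -horner_exp (le_trans (crude _ _ z1))//.
  rewrite rmorphXn/= nrm_normalX; last exact: normal_horner_alg.
  rewrite ler_wpM2r ?exprn_ge0 ?nrm_ge0// -natrM ler_nat.
  apply: leq_trans (size_poly_exp_leq _ _) _.
  have : (0 < 2 ^ k)%N by rewrite expn_gt0.
  by move: (2 ^ k)%N => N N0; case: (size q) => [|s] /=; nia.
move=> ga z z1; apply/ler_addgt0Pr => e e0.
have e2 : 0 < e / 2 by rewrite divr_gt0.
have [p [b [[n [q [bE Hq]]] gp ab]]] := ga _ e2.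
have bn : nrm b = nrm (horner_alg V q).
  rewrite bE nrm_unitaryl//; apply: unitaryX.
  by case: uV => h1 h2; split; rewrite starK.
have pn : nrm (p z : C) = nrm (q.[z] : C).
  by rewrite Hq// nrmcM nrmcX nrmc_conj z1 expr1n mul1r.
have := polyge q z z1; have := gp z z1; have := nrmcD (g z - p z) (p z).
rewrite subrK pn -bn; have := nrmD (b - a) a; rewrite subrK nrmBC.
by move=> *; lra.
Qed.

End naturality.

Section conjugation.
Context (R : realType) (A : cstarAlgType R) (U : A).

Definition conj_by of unitary U := fun x : A => star U * x * U.

Variable uU : unitary U.

Let conj_by_linear : linear (conj_by uU).
Proof.
move=> c x y; rewrite /conj_by mulrDr mulrDl -scalerAr -scalerAl; reflexivity.
Qed.
HB.instance Definition _ :=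
  GRing.isLinear.Build R[i] A A _ (conj_by uU) conj_by_linear.

Let conj_by_monoid : monoid_morphism (conj_by uU).
Proof.
split; first by rewrite /conj_by mulr1; case: uU.
move=> x y; rewrite /conj_by -!mulrA; congr (_ * (_ * _)).
by rewrite (mulrA U) (proj2 uU) mul1r.
Qed.
HB.instance Definition _ :=
  GRing.isMonoidMorphism.Build A A (conj_by uU) conj_by_monoid.

Let conj_by_star : {morph conj_by uU : x / star x}.
Proof. by move=> x; rewrite /conj_by !starM starK mulrA. Qed.
HB.instance Definition _ := isStarMorphism.Build R A A (conj_by uU) conj_by_star.

Lemma fcalc_conj (V : A) (w : R[i]) g a : unitary V -> nrm (w : R[i]) = 1 ->
  star U * V * U = w *: V ->
  fcalc V g a -> fcalc V (fun z => g (w * z)) (star U * a * U).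
Proof.
move=> uV w1 UVU ga; apply: fcalc_scale => //; rewrite -UVU.
exact: (fcalc_morph (conj_by uU)) ga.
Qed.

End conjugation.

(** * Uniform continuity on the disk and the interval *)

(** The distance is a parameter because the norms of the two ambient spaces to
    be considered, [R] and [R[i]], take values in different fields. *)
Section compact_subspaces.
Context (R : realType) (M : topologicalType) (dist : M -> M -> R) (K : set M).
Hypothesis nbhs_dist : forall (x : M) S, nbhs x S <->
  exists2 d : R, 0 < d & forall y, dist x y < d -> S y.

Lemma nbhs_subspace (x : K) (S : set K) : nbhs x S <->
  exists2 d : R, 0 < d & forall y : K, dist (val x) (val y) < d -> S y.
Proof.
split.
  case=> B [] [] O oO OB Bx OS; rewrite -OB in Bx OS.
  have /nbhs_dist[d d0 H] : nbhs (val x : M) O by exact: open_nbhs_nbhs.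
  by exists d => // y /H Oy; exact: OS.
case=> d d0 H.
have cval : continuous (fun z : K => val z : M).
  exact: (@initial_continuous K M (fun z => val z)).
have nx : nbhs (val x : M) [set z | dist (val x) z < d] by apply/nbhs_dist; exists d.
have nx' : nbhs x [set z : K | dist (val x) (val z) < d] := cval x _ nx.
apply: filterS nx' => y; exact: H.
Qed.

Context (A : cstarAlgType R).

Lemma continuous_subspace (f : K -> A) : continuous f <->
  forall x (e : R), 0 < e -> exists2 d : R, 0 < d &
    forall y, dist (val x) (val y) < d -> nrm (f x - f y) < e.
Proof.
split=> [cf x e e0|H x S /nbhs_nrm[e e0 HS]].
  have /cf/nbhs_subspace[d d0 Hd] : nbhs (f x) [set z | nrm (f x - z) < e].
    by apply/nbhs_nrm; exists e.
  by exists d.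
by apply/nbhs_subspace; have [d d0 Hd] := H x e e0; exists d => // y /Hd /HS.
Qed.

Lemma compact_bounded (f : K -> A) : compact K -> continuous f ->
  exists2 c : R, 0 <= c & forall x, nrm (f x) <= c.
Proof.
move=> cK /continuous_subspace cf.
have := (compact_near_coveringP K).1 cK R (+oo)
  (fun c x' => forall x : K, val x = x' -> nrm (f x) <= c) _.
case=> [x Kx|c /= [c0 Hc]].
  pose xK : K := exist _ x (mem_set Kx).
  have [d d0 Hd] := cf xK 1 ltr01.
  exists ([set y | dist x y < d], [set t | nrm (f xK) + 1 < t]); first split => /=.
  - by apply/nbhs_dist; exists d.
  - by exists (nrm (f xK) + 1); split; first exact: num_real.
  move=> [x' t]/= [xx' td] y yx'.
  have h1 : nrm (f xK - f y) < 1 by apply: Hd; rewrite -yx' in xx'.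
  have h2 := nrmD (f y - f xK) (f xK).
  by move: h2; rewrite subrK nrmBC => h2; lra.
exists (Num.max 0 (c + 1)); first by rewrite le_max lexx.
move=> x; apply: (Hc (Num.max 0 (c + 1))) (set_valP x) _ erefl.
by rewrite lt_max ltrDl ltr01 orbT.
Qed.

Hypothesis dist_trans : forall y x z, dist x z <= dist x y + dist y z.

Lemma heine_cantor (f : K -> A) : compact K -> continuous f ->
  forall e : R, 0 < e -> exists2 d : R, 0 < d &
    forall x y, dist (val x) (val y) < d -> nrm (f x - f y) <= e.
Proof.
move=> cK /continuous_subspace cf e e0.
have e2 : 0 < e / 2 by rewrite divr_gt0.
pose P (d : R) (x' : M) := forall x y : K, val x = x' ->
  dist (val x) (val y) < d -> nrm (f x - f y) <= e.
have := (compact_near_coveringP K).1 cK R (0^'+) P _.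
case=> [x Kx|d /= d0 Hd].
  pose xK : K := exist _ x (mem_set Kx).
  have [d d0 Hd] := cf xK _ e2.
  have d2 : 0 < d / 2 by rewrite divr_gt0.
  exists ([set y | dist x y < d / 2], [set t | 0 < t < d / 2]); first split => /=.
  - by apply/nbhs_dist; exists (d / 2).
  - exists (d / 2) => //= t; rewrite /ball_/= sub0r normrN => td t0.
    by rewrite t0 -[t]gtr0_norm.
  move=> [x' t]/= [xx' /andP[t0 td]] y z yx' yz.
  have h1 := Hd y; have h2 := Hd z; rewrite /= in h1 h2.
  have n1 : nrm (f xK - f y) < e / 2 by apply: h1; rewrite yx'; lra.
  have n2 : nrm (f xK - f z) < e / 2.
    apply: h2; apply: le_lt_trans (dist_trans (val y) _ _) _.
    by move: yz; rewrite yx' => yz; lra.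
  apply: le_trans (nrmB_trans (f xK) _ _) _; rewrite nrmBC.
  by lra.
have d2 : 0 < d / 2 by rewrite divr_gt0.
exists (d / 2) => // x y; apply: (Hd (d / 2)) => //=.
  by rewrite sub0r normrN gtr0_norm//; lra.
exact: set_valP.
Qed.

End compact_subspaces.

Section disk_and_interval.
Context (R : realType).
Local Notation C := R[i].

(** The disk is a closed subset of the image of a square of the real plane. *)
Lemma compact_disk : compact (@closed_disk R).
Proof.
pose h (p : R * R) : C := p.1 +i* p.2.
pose Q := `[-1 : R, 1]%classic `*` `[-1 : R, 1]%classic.
have ch : continuous h.
  move=> [x y] S /(@nbhs_nrm R R[i])[e e0 HS].
  have e2 : 0 < e / 2 by rewrite divr_gt0.
  exists ([set u | `|x - u| < e / 2], [set v | `|y - v| < e / 2]).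
    split => /=.
    - by exists (e / 2).
    - by exists (e / 2).
  move=> [u v]/= [xu yv]; apply: HS.
  have -> : h (x, y) - h (u, v) = (x - u)%:C + 'i * (y - v)%:C :> C.
    by rewrite /h/=; apply/eqP; rewrite eq_complex/=; apply/andP; split; apply/eqP; ring.
  apply: le_lt_trans (nrmcD _ _) _; rewrite nrmcM !nrmc_real.
  have -> : nrm ('i : C) = 1 by rewrite /nrm normCi.
  by rewrite mul1r; lra.
have cQ : compact (h @` Q).
  apply: continuous_compact; first exact: continuous_subspaceT.
  by apply: compact_setX; exact: segment_compact.
apply: subclosed_compact cQ _.
  apply/(@closed_nrm R R[i]) => z H; rewrite /closed_disk /= -nrm_le.
  apply/ler_addgt0Pr => e e0; have [w w1 zw] := H e e0.
  rewrite -[z](subrK w); apply: le_trans (nrmcD _ _) _.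
  by move: w1; rewrite /closed_disk /= -[1 in X in X -> _]/(1%:C) -nrm_le => w1; lra.
move=> z; rewrite /closed_disk /= -nrm_le => z1; exists (complex.Re z, complex.Im z).
  split; rewrite /= in_itv/= -ler_norml.
    by apply: le_trans z1; rewrite -lecR -normE; exact: normc_ge_Re.
  apply: le_trans z1; rewrite -lecR -normE.
  by rewrite normc_def lecR -sqrtr_sqr ler_wsqrtr// lerDr sqr_ge0.
by rewrite /h; case: z {z1}.
Qed.

Lemma disk_uniform (f : continuousType (disk R) R[i]) (e : R) : 0 < e ->
  exists2 d : R, 0 < d & forall x y : disk R,
    nrm (val x - val y : C) < d -> nrm (f x - f y : C) <= e.
Proof.
apply: (@heine_cantor R R[i] (fun x y => nrm (x - y : C)) (@closed_disk R) _ R[i]).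
- exact: nbhs_nrm.
- by move=> y x z; exact: (@nrmB_trans R R[i]).
- exact: compact_disk.
- exact: cts_fun.
Qed.

Lemma nbhs_real (x : R) S : nbhs x S <->
  exists2 d : R, 0 < d & forall y, `|x - y| < d -> S y.
Proof.
split => [/nbhs_ballP[e /= e0 H]|[e e0 H]]; last by exists e.
by exists e.
Qed.

Lemma interval_uniform (A : cstarAlgType R)
    (f : continuousType (unit_interval R) A) (e : R) : 0 < e ->
  exists2 d : R, 0 < d & forall s t : unit_interval R,
    `|val s - val t| < d -> nrm (f s - f t) <= e.
Proof.
apply: (@heine_cantor R R (fun x y => `|x - y|) `[0 : R, 1]%classic _ A).
- exact: nbhs_real.
- by move=> y x z; rewrite -[x - z](subrKA y) ler_normD.
- exact: segment_compact.
- exact: cts_fun.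
Qed.

Lemma interval_continuous (A : cstarAlgType R) (f : unit_interval R -> A) :
  (forall t (e : R), 0 < e -> exists2 d : R, 0 < d &
    forall s, `|val t - val s| < d -> nrm (f t - f s) < e) -> continuous f.
Proof. by move=> H; exact/(continuous_subspace nbhs_real). Qed.

Lemma interval_continuousP (A : cstarAlgType R) (f : unit_interval R -> A) :
  continuous f -> forall t (e : R), 0 < e -> exists2 d : R, 0 < d &
    forall s, `|val t - val s| < d -> nrm (f t - f s) < e.
Proof. by move=> cf; exact/(continuous_subspace nbhs_real). Qed.

Lemma disk_bounded (f : continuousType (disk R) R[i]) :
  exists2 K : R, 0 <= K & forall z, nrm (f z : C) <= K.
Proof.
apply: (@compact_bounded R R[i] (fun x y => nrm (x - y : C)) (@closed_disk R) _ R[i]).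
- exact: nbhs_nrm.
- exact: compact_disk.
- exact: cts_fun.
Qed.

End disk_and_interval.

(** * Evaluation at the dilates of a unitary *)

Section circles_in_the_disk.
Context (R : realType).
Local Notation C := R[i].

Definition to_disk (z : C) : disk R :=
  if pselect (z \in @closed_disk R) is left h then exist _ z h else point.

Lemma to_diskE (z : C) : nrm (z : C) <= 1 -> val (to_disk z) = z.
Proof.
rewrite /to_disk => z1; case: pselect => // -[].
by rewrite inE /closed_disk/= -nrm_le.
Qed.

Lemma disk_le1 (z : disk R) : nrm (val z : C) <= 1.
Proof. by have := set_valP z; rewrite /closed_disk/= nrm_le. Qed.

Lemma interval_itv (t : unit_interval R) : 0 <= val t <= 1.
Proof. by have := set_valP t; rewrite /= in_itv. Qed.

Lemma nrm_dilate (t : unit_interval R) (z : C) : nrm (z : C) = 1 ->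
  nrm ((val t)%:C * z : C) = val t.
Proof.
move=> z1; rewrite nrmcM z1 mulr1 nrmc_real ger0_norm//.
by have /andP[] := interval_itv t.
Qed.

Lemma val_dilate (t : unit_interval R) (z : C) : nrm (z : C) = 1 ->
  val (to_disk ((val t)%:C * z)) = (val t)%:C * z.
Proof.
move=> z1; rewrite to_diskE// nrm_dilate//.
by have /andP[] := interval_itv t.
Qed.

Definition on_circle (f : disk R -> C) (t : unit_interval R) (z : C) : C :=
  f (to_disk ((val t)%:C * z)).

Lemma polar (z : disk R) : exists (t : unit_interval R) (w : C),
  nrm (w : C) = 1 /\ forall f, f z = on_circle f t w.
Proof.
have t01 : nrm (val z : C) \in `[0 : R, 1]%classic.
  by rewrite inE/= in_itv/= nrm_ge0 disk_le1.
pose t : unit_interval R := exist (fun x => x \in `[0 : R, 1]%classic) _ t01.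
exists t; have [z0|z0] := eqVneq (val z : C) 0.
  exists 1; split=> [|f]; first by rewrite nrmc_real normr1.
  congr f; apply: val_inj; rewrite val_dilate ?nrmc_real ?normr1//= z0 nrm0.
  by rewrite mul0r.
have n0 : nrm (val z : C) != 0.
  by apply: contra z0 => /eqP n0; rewrite (@nrm_eq0 R R[i] (val z)) ?n0.
have n0C : (nrm (val z : C))%:C != 0 :> C by apply: contra_neq n0 => -[].
have w1 : nrm ((nrm (val z : C))%:C^-1 * val z : C) = 1.
  by rewrite nrmcM -fmorphV nrmc_real ger0_norm ?invr_ge0 ?nrm_ge0// mulVf.
exists ((nrm (val z : C))%:C^-1 * val z); split => // f.
by congr f; apply: val_inj; rewrite val_dilate//= mulrA divff// mul1r.
Qed.

End circles_in_the_disk.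

Section evaluation.
Context (R : realType) (A : cstarAlgType R) (V : A).
Hypothesis uV : unitary V.
Local Notation C := R[i].
Local Notation CD := (continuousType (disk R) C).

Lemma fcalc_circle (f : CD) (t : unit_interval R) :
  exists a, fcalc V (on_circle f t) a.
Proof.
have [K K0 fK] := disk_bounded f.
apply: (@fcalc_exists _ _ _ uV _ K) => [z z1|e e0]; first exact: fK.
have [d d0 Hd] := disk_uniform f e0; exists d => // z w z1 w1 zw.
apply: Hd; rewrite !val_dilate// -mulrBr nrmcM nrmc_real.
have /andP[t0 t1] := interval_itv t; rewrite ger0_norm//.
by apply: le_lt_trans zw; rewrite ler_piMl ?nrm_ge0.
Qed.

(** The element [f (t V)] of the functional calculus of the normal element
    [t V], for [f] on the disk. *)
Definition eval_at (t : unit_interval R) (f : CD) : A :=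
  projT1 (cid (fcalc_circle f t)).

Local Notation ev := eval_at.

Lemma fcalc_eval t (f : CD) : fcalc V (on_circle f t) (ev t f).
Proof. exact: projT2 (cid (fcalc_circle f t)). Qed.

Lemma eval_eq t (f : CD) a : fcalc V (on_circle f t) a -> ev t f = a.
Proof. exact: (fcalc_uniq uV (fcalc_eval t f)). Qed.

Let eval_linear t : linear (ev t).
Proof.
move=> c f g; apply: eval_eq.
have := fcalcM uV (fcalc_trig (trig_const V c)) (fcalc_eval t f).
rewrite -scalerAl mul1r => /(fcalcD uV)/(_ (fcalc_eval t g)).
exact: fcalc_ext.
Qed.
HB.instance Definition _ t :=
  GRing.isLinear.Build R[i] CD A _ (ev t) (@eval_linear t).

Let eval_monoid t : monoid_morphism (ev t).
Proof.
split.
  apply: eval_eq; have := fcalc_trig (trig_const V 1); rewrite scale1r.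
  exact: fcalc_ext.
move=> f g; apply: eval_eq.
by have := fcalcM uV (fcalc_eval t f) (fcalc_eval t g); apply: fcalc_ext.
Qed.
HB.instance Definition _ t :=
  GRing.isMonoidMorphism.Build CD A (ev t) (@eval_monoid t).

Let eval_star t : {morph ev t : f / star f}.
Proof.
move=> f; apply: eval_eq.
by have := fcalc_star uV (fcalc_eval t f); apply: fcalc_ext.
Qed.
HB.instance Definition _ t :=
  isStarMorphism.Build R CD A (ev t) (@eval_star t).

Lemma eval_at_continuous (f : CD) : continuous (fun t => ev t f).
Proof.
apply: interval_continuous => t e e0.
have e2 : 0 < e / 2 by rewrite divr_gt0.
have [d d0 Hd] := disk_uniform f e2; exists d => // s ts.
apply: (@le_lt_trans _ _ (e / 2)); last by lra.
apply: (fcalc_bound uV (fcalc_eval t f) (fcalc_eval s f)) => z z1.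
apply: Hd; rewrite !val_dilate// -mulrBl nrmcM z1 mulr1 -rmorphB/=.
by rewrite nrmc_real.
Qed.

(** Conjugation by [U] is an endomorphism rotating [V], hence it rotates the
    argument of every function of [V]. *)
Lemma eval_rotation (U : A) theta t (f : CD) : unitary U ->
    V * U = expi (2 * pi * theta) *: (U * V) ->
  star U * ev t f * U = ev t (f \o rotation theta).
Proof.
move=> uU VU; apply/esym; apply: eval_eq.
have n1 : nrm (expi (2 * pi * theta) : C) = 1.
  by rewrite /nrm norm_expi.
have UVU : star U * V * U = expi (2 * pi * theta) *: V.
  by rewrite -mulrA VU -scalerAr mulrA uU.1 mul1r.
apply: fcalc_ext (fcalc_conj uU uV n1 UVU (fcalc_eval t f)) => z z1.
rewrite /on_circle/=; congr (f _); apply: val_inj.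
by rewrite /= val_dilate ?unimodularM// val_dilate// mulrCA.
Qed.

End evaluation.

(** * Generated subalgebras and functions on the disk *)

Section subalgebras.
Context (R : realType) (A : cstarAlgType R).

Lemma cstar_generated_subalgebra (G : set A) :
  cstar_subalgebra (cstar_generated G).
Proof.
split.
- by apply: closed_bigI => S [[]].
- by move=> S [[]].
- by move=> x y Sx Sy S HS; case: (HS.1) => _ _ h _ _; apply: h; [exact: Sx|exact: Sy].
- by move=> c x Sx S HS; case: (HS.1) => _ _ _ h _; apply: h; exact: Sx.
split=> [x y Sx Sy S HS|x Sx S HS]; case: (HS.1) => _ _ _ _ [h1 h2].
  by apply: h1; [exact: Sx|exact: Sy].
by apply: h2; exact: Sx.
Qed.

Lemma cstar_generated_incl (G : set A) x : G x -> cstar_generated G x.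
Proof. by move=> Gx S [_]; exact. Qed.

Lemma cstar_generated_ind (G S : set A) : cstar_subalgebra S -> G `<=` S ->
  cstar_generated G `<=` S.
Proof. by move=> cS GS x; apply; split. Qed.

Lemma closure_subalgebra (S : set A) : S 0 ->
    (forall x y, S x -> S y -> S (x + y)) ->
    (forall (c : R[i]) x, S x -> S (c *: x)) ->
    (forall x y, S x -> S y -> S (x * y)) -> (forall x, S x -> S (star x)) ->
  cstar_subalgebra
    [set x | forall e : R, 0 < e -> exists2 y, S y & nrm (x - y) < e].
Proof.
move=> S0 SD SZ SM Ss; split=> /=.
- apply/closed_nrm => x H e e0; have e2 : 0 < e / 2 by rewrite divr_gt0.
  have [y Hy xy] := H _ e2; have [z Sz yz] := Hy _ e2; exists z => //.
  by apply: le_lt_trans (nrmB_trans y _ _) _; lra.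
- by move=> e e0; exists 0; rewrite ?subrr ?nrm0.
- move=> x y Hx Hy e e0; have e2 : 0 < e / 2 by rewrite divr_gt0.
  have [x' Sx xx] := Hx _ e2; have [y' Sy yy] := Hy _ e2.
  exists (x' + y'); first exact: SD.
  by rewrite opprD addrACA; apply: le_lt_trans (nrmD _ _) _; lra.
- move=> c x Hx e e0.
  have c0 : 0 < nrm (c : R[i]) + 1 by rewrite ltr_wpDl ?nrm_ge0.
  have [x' Sx xx] := Hx _ (divr_gt0 e0 c0); exists (c *: x'); first exact: SZ.
  rewrite -scalerBr nrmZ; move: xx; rewrite ltr_pdivlMr// => xx.
  apply: le_lt_trans xx; rewrite mulrC ler_wpM2l ?nrm_ge0//.
  by rewrite lerDl.
split.
- move=> x y Hx Hy e e0.
  pose K := nrm x + nrm y + 2; have K0 : 0 < K by rewrite ltr_wpDl// addr_ge0// nrm_ge0.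
  pose d := Num.min 1 (e / K).
  have d0 : 0 < d by rewrite lt_min ltr01 divr_gt0.
  have d1 : d <= 1 by rewrite ge_min lexx.
  have dK : d * K <= e by rewrite -ler_pdivlMr// ge_min lexx orbT.
  have [x' Sx xx] := Hx _ d0; have [y' Sy yy] := Hy _ d0.
  exists (x' * y'); first exact: SM.
  have -> : x * y - x' * y' = x * (y - y') + (x - x') * y'.
    by rewrite mulrBr mulrBl addrA subrK.
  apply: lt_le_trans dK; apply: le_lt_trans (nrmD _ _) _.
  have h1 : nrm (x * (y - y')) <= nrm x * d.
    by apply: le_trans (nrmM _ _) _; rewrite ler_wpM2l ?nrm_ge0// ltW.
  have ny' : nrm y' <= nrm y + 1.
    rewrite -[y'](subrK y) (le_trans (nrmD _ _))// addrC lerD// nrmBC.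
    by rewrite (le_trans (ltW yy)).
  have h2 : nrm ((x - x') * y') <= d * (nrm y + 1).
    by apply: le_trans (nrmM _ _) _; apply: ler_pM; rewrite ?nrm_ge0// ltW.
  by rewrite /K; lra.
- move=> x Hx e e0; have [x' Sx xx] := Hx _ e0.
  by exists (star x'); [exact: Ss|rewrite -starB nrm_star].
Qed.

End subalgebras.

Section continuous_functions_on_the_disk.
Context (R : realType).
Local Notation C := R[i].
Local Notation CD := (continuousType (disk R) C).

Lemma nrm_continuous : continuous (fun z : C => nrm (z : C) : R).
Proof.
move=> z S /nbhs_real[e e0 H]; apply/(@nbhs_nrm R R[i]); exists e => // w zw.
apply: H; apply: le_lt_trans zw; rewrite ler_norml.
have := @nrmB_trans R R[i] z w 0; have := @nrmB_trans R R[i] w z 0.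
rewrite !subr0 [nrm (w - z : C)]nrmBC => h1 h2.
by apply/andP; split; lra.
Qed.

Lemma real_complex_continuous : continuous (fun x : R => x%:C : C).
Proof.
move=> x S /(@nbhs_nrm R R[i])[e e0 H]; apply/nbhs_real; exists e => // y xy.
by apply: H; rewrite -rmorphB/= nrmc_real.
Qed.

Let of_norm_cts (f : CD) (g : R -> R) (cg : continuous g) :
  continuous (fun z => (g (nrm (f z : C)))%:C : C).
Proof.
move=> z; apply: (@continuous_comp _ _ _ (fun z => g (nrm (f z : C))) (fun x => x%:C)).
  apply: (@continuous_comp _ _ _ (fun z => nrm (f z : C)) g); last exact: cg.
  apply: (@continuous_comp _ _ _ f (fun z => nrm (z : C))); first exact: cts_fun.
  exact: nrm_continuous.
exact: real_complex_continuous.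
Qed.

Definition of_norm (f : CD) (g : R -> R) (cg : continuous g) : CD :=
  mkcts (@of_norm_cts f g cg).

Let val_cts : continuous (fun z : disk R => val z : C).
Proof. exact: (@initial_continuous (disk R) C (fun z => val z)). Qed.

Definition disk_coordinate : CD := mkcts val_cts.

Definition radial (g : R -> R) (cg : continuous g) : CD :=
  of_norm disk_coordinate cg.

(** With [d] slightly larger than [c], the function [h = |f| ^ 2 / d ^ 2] is the
    real part of the unitary function [h + 'i sqrt (1 - h ^ 2)]. Unitaries have
    norm one wherever they are mapped, so [rho h] has norm at most one, and the
    C*-identity concludes. *)
Lemma sup_norm_bound (D : cstarAlgType R) (rho : {starhom CD -> D}) (f : CD)
    (c : R) : 0 <= c -> (forall z, nrm (f z : C) <= c) -> nrm (rho f) <= c.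
Proof.
move=> c0 fc; apply/ler_addgt0Pr => e e0; set d := c + e.
have d0 : 0 < d by rewrite ltr_wpDl.
pose g1 (x : R) := x ^+ 2 / d ^+ 2.
pose g2 (x : R) := Num.sqrt (1 - g1 x ^+ 2).
have cg1 : continuous g1.
  by move=> x; apply: cvgMr_tmp; exact: exprn_continuous.
have cg2 : continuous g2.
  move=> x; apply: (@continuous_comp _ _ _ (fun x => 1 - g1 x ^+ 2) Num.sqrt).
    apply: cvgB; first exact: cvg_cst.
    apply: (@continuous_comp _ _ _ g1 (fun y => y ^+ 2)); first exact: cg1.
    exact: exprn_continuous.
  exact: sqrt_continuous.
pose h := of_norm f cg1; pose k := of_norm f cg2.
have conjr (x : R) : (x%:C)^* = x%:C :> C by rewrite conj_Creal ?complex_real.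
have g01 z : 0 <= 1 - g1 (nrm (f z : C)) ^+ 2.
  rewrite subr_ge0 exprn_ile1//.
    by rewrite divr_ge0// ?exprn_ge0 ?nrm_ge0// ltW.
  rewrite ler_pdivrMr ?exprn_gt0// mul1r ler_pXn2r ?nnegrE ?nrm_ge0// ?ltW//.
  by apply: le_lt_trans (fc z) _; rewrite ltrDl.
have E z : (g1 (nrm (f z : C)))%:C ^+ 2 + (g2 (nrm (f z : C)))%:C ^+ 2 = 1 :> C.
  rewrite -!rmorphXn -rmorphD/= sqr_sqrtr ?g01// addrC subrK.
  by rewrite rmorph1.
have ii : 'i * 'i = - 1 :> C by rewrite -expr2 sqrCi.
have uu : unitary (h + 'i *: k).
  split; apply/continuousEP => z; have Ez := E z.
    have -> : (star (h + 'i *: k) * (h + 'i *: k)) z =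
        ((g1 (nrm (f z : C)))%:C + 'i * (g2 (nrm (f z : C)))%:C)^* *
        ((g1 (nrm (f z : C)))%:C + 'i * (g2 (nrm (f z : C)))%:C) :> C by [].
    rewrite rmorphD rmorphM/= !conjr conjCi.
    rewrite -[RHS]/(1 : C) -Ez; ring: ii.
  have -> : ((h + 'i *: k) * star (h + 'i *: k)) z =
      ((g1 (nrm (f z : C)))%:C + 'i * (g2 (nrm (f z : C)))%:C) *
      ((g1 (nrm (f z : C)))%:C + 'i * (g2 (nrm (f z : C)))%:C)^* :> C by [].
  rewrite rmorphD rmorphM/= !conjr conjCi.
  rewrite -[RHS]/(1 : C) -Ez; ring: ii.
have hE : h = 2^-1 *: ((h + 'i *: k) + star (h + 'i *: k)).
  apply/continuousEP => z.
  have -> : (2^-1 *: ((h + 'i *: k) + star (h + 'i *: k))) z =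
      2^-1 * (((g1 (nrm (f z : C)))%:C + 'i * (g2 (nrm (f z : C)))%:C) +
      ((g1 (nrm (f z : C)))%:C + 'i * (g2 (nrm (f z : C)))%:C)^*) :> C by [].
  rewrite rmorphD rmorphM/= !conjr conjCi -[LHS]/((g1 (nrm (f z : C)))%:C : C).
  by field.
have h1 : nrm (rho h) <= 1.
  have ru := starhom_unitary rho uu.
  rewrite hE linearZ/= rmorphD/= star_morph nrmZ.
  have -> : 2^-1 = (2^-1)%:C :> C by rewrite fmorphV rmorph_nat.
  rewrite nrmc_real ger0_norm ?invr_ge0//.
  have := nrmD (rho (h + 'i *: k)) (star (rho (h + 'i *: k))).
  by rewrite nrm_star !(nrm_unitary ru) => ?; lra.
have ff : star f * f = (d ^+ 2)%:C *: h.
  apply/continuousEP => z.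
  have -> : ((d ^+ 2)%:C *: h) z = (d ^+ 2)%:C * (g1 (nrm (f z : C)))%:C :> C by [].
  have -> : (star f * f) z = (f z)^* * f z :> C by [].
  rewrite -rmorphM/= /g1 [d ^+ 2 * _]mulrC divfK ?expf_neq0 ?gt_eqF//.
  by rewrite rmorphXn/= -normE normCK mulrC.
rewrite -(@ler_pXn2r _ 2) ?nnegrE ?nrm_ge0 ?(ltW d0)//.
rewrite -nrm_starM -star_morph -rmorphM/= ff linearZ/= nrmZ nrmc_real.
have d2 : 0 <= d ^+ 2 by rewrite exprn_ge0// ltW.
by rewrite ger0_norm// ler_piMr.
Qed.

End continuous_functions_on_the_disk.

(** * Laurent sums in the crossed product *)

Section laurent_sums.
Context (R : realType) (theta : R).
Local Notation C := R[i].
Local Notation CD := (continuousType (disk R) C).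
Context (B : cstarAlgType R) (iota : {starhom CD -> B}) (W : B).
Hypothesis cov : covariant (rotation theta) iota W.

Let uW : unitary W := cov.1.

(** Gathering the negative powers of [W] in a common factor leaves natural
    exponents; the number [m] of terms is what norm estimates depend on. *)
Definition laurent N m (x : B) := exists f : nat -> CD,
  x = \sum_(i < m) star W ^+ N * iota (f i) * W ^+ i.

Let sWK n : star W ^+ n * W ^+ n = 1.
Proof.
elim: n => [|n ih]; first by rewrite !expr0 mulr1.
by rewrite exprSr exprS -mulrA (mulrA (star W)) uW.1 mul1r.
Qed.

Let starWX n : star (W ^+ n) = star W ^+ n.
Proof. by elim: n => [|n ih]; rewrite ?star1// exprS starM ih -exprSr. Qed.

Let starWXs n : star (star W ^+ n) = W ^+ n.
Proof. by rewrite -starWX starK. Qed.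

Let unrotate (f : CD) : (f \o rotation (- theta)) \o rotation theta = f :> CD.
Proof. by apply/continuousEP => z /=; rewrite rotationK. Qed.

Let push_star (f : CD) n : exists g : CD,
  iota f * star W ^+ n = star W ^+ n * iota g.
Proof.
elim: n f => [|n ih] f; first by exists f; rewrite !expr0 mulr1 mul1r.
pose h : CD := f \o rotation (- theta).
have E : iota f * star W = star W * iota h.
  by rewrite -[in LHS](unrotate f) -(cov.2 h) -!mulrA uW.2 mulr1.
have [g Hg] := ih h; exists g.
by rewrite exprS [LHS]mulrA E -[LHS]mulrA Hg mulrA.
Qed.

Let push (f : CD) n : exists g : CD, W ^+ n * iota f = iota g * W ^+ n.
Proof.
elim: n f => [|n ih] f; first by exists f; rewrite !expr0 mulr1 mul1r.
pose h : CD := f \o rotation (- theta).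
have E : W * iota f = iota h * W.
  by rewrite -[in LHS](unrotate f) -(cov.2 h) !mulrA uW.2 mul1r.
have [g Hg] := ih h; exists g.
by rewrite exprSr -[LHS]mulrA E [LHS]mulrA Hg -mulrA.
Qed.

Lemma laurentD N m x y : laurent N m x -> laurent N m y -> laurent N m (x + y).
Proof.
move=> [f ->] [g ->]; exists (fun i => f i + g i); rewrite -big_split/=.
by apply: eq_bigr => i _; rewrite rmorphD/= mulrDr mulrDl.
Qed.

Lemma laurentZ N m (c : C) x : laurent N m x -> laurent N m (c *: x).
Proof.
move=> [f ->]; exists (fun i => c *: f i); rewrite scaler_sumr.
by apply: eq_bigr => i _; rewrite linearZ/= -scalerAr -scalerAl.
Qed.

Lemma laurent0 N m : laurent N m 0.
Proof. by exists (fun=> 0); rewrite big1// => i _; rewrite rmorph0 mulr0 mul0r. Qed.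

Lemma laurent_sum N m (I : Type) (r : seq I) (x : I -> B) :
  (forall i, laurent N m (x i)) -> laurent N m (\sum_(i <- r) x i).
Proof.
move=> H; elim: r => [|i r ih]; first by rewrite big_nil; exact: laurent0.
by rewrite big_cons; apply: laurentD.
Qed.

Lemma laurent_mono N m i (f : CD) : (i < m)%N ->
  laurent N m (star W ^+ N * iota f * W ^+ i).
Proof.
move=> im; exists (fun j => if j == i then f else 0).
rewrite (bigD1 (Ordinal im))//= eqxx big1 ?addr0// => j.
by rewrite -val_eqE/= => /negbTE ->; rewrite rmorph0 mulr0 mul0r.
Qed.

(** Inserting [star W ^ k * W ^ k = 1] raises the power of [star W] at the cost
    of [k] more terms, which makes sums with different powers comparable. *)
Lemma laurent_widen N k m n x : (m + k <= n)%N ->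
  laurent N m x -> laurent (N + k) n x.
Proof.
move=> mn [f ->]; apply: laurent_sum => i.
have -> : star W ^+ N * iota (f i) * W ^+ i =
    star W ^+ (N + k) * (W ^+ k * iota (f i)) * W ^+ i.
  by rewrite exprD -!mulrA (mulrA (star W ^+ k)) sWK mul1r.
have [g ->] := push (f i) k; rewrite mulrA -[_ * W ^+ k * _]mulrA -exprD.
by apply: laurent_mono; rewrite addnC (leq_trans _ mn)// ltn_add2r.
Qed.

(** The widths add because powers of [W] move across functions on the disk at
    the cost of rotating them. *)
Lemma laurentM N N' m m' x y : laurent N m x -> laurent N' m' y ->
  laurent (N + N') (m + m') (x * y).
Proof.
move=> [f ->] [g ->]; rewrite mulr_suml; apply: laurent_sum => i.
rewrite mulr_sumr; apply: laurent_sum => j.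
have comW : W ^+ i * star W ^+ N' = star W ^+ N' * W ^+ i.
  have c : GRing.comm W (star W) by rewrite /GRing.comm uW.1 uW.2.
  exact/commrX/commr_sym/commrX/commr_sym.
have [f' Hf] := push_star (f i) N'; have [g' Hg] := push (g j) i.
have -> : star W ^+ N * iota (f i) * W ^+ i * (star W ^+ N' * iota (g j) * W ^+ j)
    = star W ^+ (N + N') * iota (f' * g') * W ^+ (i + j).
  rewrite rmorphM/= !exprD -!mulrA; congr (_ * _).
  rewrite (mulrA (W ^+ i)) comW -!mulrA (mulrA (W ^+ i) (iota _)) Hg.
  by rewrite -!mulrA (mulrA (iota (f i))) Hf !mulrA.
by apply: laurent_mono; rewrite -addSn leq_add// ltnW.
Qed.

Lemma laurent_star N m x : laurent N m x -> laurent m (N.+1 + m) (star x).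
Proof.
move=> [f ->]; rewrite (big_morph _ (@starD _ B) (star0 B)).
apply: laurent_sum => i; rewrite !starM starWX starWXs -star_morph.
have -> : star W ^+ i * (iota (star (f i)) * W ^+ N) =
  star W ^+ i * iota (star (f i)) * W ^+ N by rewrite mulrA.
(* The terms have different powers of [star W], all at most [star W ^+ m]. *)
have im : (i <= m)%N by exact: ltnW.
rewrite -[X in laurent X](subnKC im); apply: (@laurent_widen i _ N.+1).
  by rewrite leq_add2l leq_subr.
exact: laurent_mono.
Qed.

Lemma laurentX N m x k : laurent N m x -> laurent (k * N) (k * m).+1 (x ^+ k).
Proof.
move=> H; elim: k => [|k ih].
  rewrite expr0 !mul0n; have := @laurent_mono 0 1 0 1 isT.
  by rewrite rmorph1 !expr0 !mulr1.
by rewrite exprS !mulSn -addnS; apply: laurentM.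
Qed.

Lemma laurent_dense : cstar_generated (range iota `|` [set W]) = setT ->
  forall x (e : R), 0 < e -> exists y, (exists N m, laurent N m y) /\ nrm (x - y) < e.
Proof.
move=> gen x e e0.
pose S : set B := [set y | exists N m, laurent N m y].
suff H : cstar_generated (range iota `|` [set W]) `<=`
    [set x | forall e : R, 0 < e -> exists2 y, S y & nrm (x - y) < e].
  by have [|y Sy xy] := H x _ _ e0; [rewrite gen|exists y].
apply: cstar_generated_ind.
  apply: closure_subalgebra.
  - by exists 0, 0; exact: laurent0.
  - move=> y z [N [m Hy]] [N' [m' Hz]].
    exists (N + N')%N, (m + N' + (m' + N))%N; apply: laurentD.
      by apply: laurent_widen Hy; rewrite leq_addr.
    by rewrite addnC; apply: laurent_widen Hz; rewrite leq_addl.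
  - by move=> c y [N [m Hy]]; exists N, m; exact: laurentZ.
  - by move=> y z [N [m Hy]] [N' [m' Hz]]; exists (N + N')%N, (m + m')%N; exact: laurentM.
  - by move=> y [N [m Hy]]; exists m, (N.+1 + m)%N; exact: laurent_star.
move=> y Hy d d0; exists y; last by rewrite subrr nrm0.
case: Hy => [[f _ <-]|->].
  exists 0, 1; have := @laurent_mono 0 1 0 f isT.
  by rewrite !expr0 mulr1 mul1r.
exists 0, 2; have := @laurent_mono 0 2 1 1 isT.
by rewrite rmorph1 !expr0 expr1 !mul1r.
Qed.

End laurent_sums.

(** * The representations indexed by the interval *)

Section representations.
Context (R : realType) (theta : R).
Local Notation C := R[i].
Local Notation CD := (continuousType (disk R) C).
Context (B : cstarAlgType R) (iota : {starhom CD -> B}) (W : B).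
Hypothesis hB : is_crossed_product (rotation theta) iota W.
Context (A : cstarAlgType R) (U V : A).
Local Notation CI := (continuousType (unit_interval R) A).
Hypothesis hA : is_rotation_algebra theta U V.

Let uU : unitary U. Proof. by case: (rotation_algebra_relation hA). Qed.
Let uV : unitary V. Proof. by case: (rotation_algebra_relation hA). Qed.
Let VU : V * U = expi (2 * pi * theta) *: (U * V).
Proof. by case: (rotation_algebra_relation hA). Qed.
Let uW : unitary W. Proof. by case: (crossed_product_covariant hB). Qed.

Let nrm_one : nrm (1 : C) = 1.
Proof. by rewrite nrmc_real normr1. Qed.

(** The commutation relation is homogeneous in [U] and in [V]. *)
Lemma gauge_automorphism (z w : C) : nrm (z : C) = 1 -> nrm (w : C) = 1 ->
  exists f : {starhom A -> A}, f U = z *: U /\ f V = w *: V.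
Proof.
move=> z1 w1; apply: (rotation_algebra_universal hA); split.
- exact: unitaryZ.
- exact: unitaryZ.
by rewrite -!scalerAl -!scalerAr VU !scalerA; congr (_ *: _); ring.
Qed.

Lemma eval_ge t (f : CD) z : nrm (z : C) = 1 ->
  nrm (on_circle f t z : C) <= nrm (eval_at uV t f).
Proof.
move=> z1; apply: (fcalc_ge uV _ (fcalc_eval uV t f)) => // w w1.
by have [g [_ gV]] := @gauge_automorphism 1 w nrm_one w1; exists g.
Qed.

Lemma rep_exists t : exists Phi : {starhom B -> A},
  (forall f, Phi (iota f) = eval_at uV t f) /\ Phi W = U.
Proof.
apply: (crossed_product_universal hB (rho := eval_at uV t)); split => // f.
exact: eval_rotation.
Qed.

(** The representation of the crossed product in the rotation algebra given by
    [f |-> f (t V)] and [W |-> U]. *)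
Definition rep t : {starhom B -> A} := projT1 (cid (rep_exists t)).

Lemma rep_iota t f : rep t (iota f) = eval_at uV t f.
Proof. by case: (projT2 (cid (rep_exists t))) => + _; exact. Qed.

Lemma rep_W t : rep t W = U.
Proof. by case: (projT2 (cid (rep_exists t))). Qed.

Lemma rep_continuous b : continuous (fun t => rep t b).
Proof.
have ctsE (f g : unit_interval R -> A) : f =1 g -> continuous g -> continuous f.
  by move=> /funext ->.
pose S : set B := [set b | continuous (fun t => rep t b)].
pose path x (Sx : S x) : CI := mkcts (Sx : continuous (fun t => rep t x)).
suff H : cstar_generated (range iota `|` [set W]) `<=` S.
  by apply: H; rewrite (crossed_product_generated hB).
apply: cstar_generated_ind.
  split.
  - apply/closed_nrm => x H; apply: interval_continuous => t e e0.
    have e3 : 0 < e / 3 by rewrite divr_gt0.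
    have [y Sy xy] := H _ e3.
    have [d d0 Hd] := interval_continuousP Sy t e3.
    exists d => // s /Hd ts.
    have h u : nrm (rep u x - rep u y) < e / 3.
      by rewrite -raddfB; apply: le_lt_trans xy; exact: starhom_contractive.
    have h1 := h t; have h2 := h s; rewrite nrmBC in h2.
    have h3 := nrmB_trans (rep s y) (rep t y) (rep s x).
    apply: le_lt_trans (nrmB_trans (rep t y) _ _) _; lra.
  - by apply: (ctsE _ (cst 0 : CI)) => [t|]; [exact: rmorph0|exact: cts_fun].
  - move=> x y Sx Sy; apply: (ctsE _ (path x Sx + path y Sy)) => [t|].
      exact: rmorphD.
    exact: cts_fun.
  - move=> c x Sx; apply: (ctsE _ (c *: path x Sx)) => [t|].
      exact: linearZ.
    exact: cts_fun.
  split.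
  - move=> x y Sx Sy; apply: (ctsE _ (path x Sx * path y Sy)) => [t|].
      exact: rmorphM.
    exact: cts_fun.
  - move=> x Sx; apply: (ctsE _ (star (path x Sx))) => [t|].
      exact: star_morph.
    exact: cts_fun.
move=> x []; last first.
  move=> ->; apply: (ctsE _ (fun=> U)) => [t|]; last exact: cst_continuous.
  exact: rep_W.
case=> f _ <-; apply: (ctsE _ (fun t => eval_at uV t f)) => [t|].
  exact: rep_iota.
exact: eval_at_continuous.
Qed.

(** Averaging over the rotations of [U], which fix the functions of [V],
    isolates the coefficients of a Laurent sum, and the functional calculus of
    the dilates of [V] sees the whole supremum of a coefficient. *)
Lemma laurent_bound N m x (c : R) : laurent iota W N m x ->
  (forall t, nrm (rep t x) <= c) -> nrm x <= m%:R * c.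
Proof.
move=> [f ->] H.
have uWs n : unitary (star W ^+ n).
  by apply: unitaryX; case: uW => h1 h2; split; rewrite starK.
have uUs n : unitary (star U ^+ n).
  by apply: unitaryX; case: uU => h1 h2; split; rewrite starK.
have repE t : rep t (\sum_(i < m) star W ^+ N * iota (f i) * W ^+ i) =
    \sum_(i < m) star U ^+ N * eval_at uV t (f i) * U ^+ i.
  rewrite rmorph_sum/=; apply: eq_bigr => i _.
  by rewrite !rmorphM !rmorphXn/= star_morph rep_W rep_iota.
rewrite (le_trans (nrm_sum _ _ _))//.
have -> : m%:R * c = \sum_(i < m) c by rewrite sumr_const card_ord mulr_natl.
apply: ler_sum => i _; rewrite nrm_unitaryr ?nrm_unitaryl//; last exact: unitaryX.
have c0 : 0 <= c by apply: le_trans (H point); exact: nrm_ge0.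
apply: sup_norm_bound => // z; have [t [w [w1 ->]]] := polar z.
apply: le_trans (eval_ge t (f i) w1) _.
rewrite -(nrm_unitaryl _ (uUs N)) -(nrm_unitaryr _ (unitaryX uU i)).
apply: (@coef_bound R A m
  (fun i => star U ^+ N * eval_at uV t (f i) * U ^+ i)) => // v v1.
have [g [gU gV]] := @gauge_automorphism v 1 v1 nrm_one.
have gev (h : CD) : g (eval_at uV t h) = eval_at uV t h.
  apply/esym/eval_eq; have := fcalc_morph g (fcalc_eval uV t h).
  by rewrite gV scale1r.
have vv : v ^+ N * (v^*) ^+ N = 1.
  by rewrite -exprMn unimodular_mul_conj// expr1n.
have -> : \sum_(j < m) v ^+ j *: (star U ^+ N * eval_at uV t (f j) * U ^+ j) =
    v ^+ N *: g (rep t (\sum_(i < m) star W ^+ N * iota (f i) * W ^+ i)).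
  rewrite repE rmorph_sum/= scaler_sumr; apply: eq_bigr => j _.
  rewrite !rmorphM !rmorphXn/= star_morph gU gev starZ !exprZn -!scalerAl -scalerAr.
  by rewrite !scalerA vv mul1r.
rewrite nrmZ unimodularX// mul1r (le_trans (starhom_contractive _ _))//.
Qed.

(** The width of the powers of [star x * x] grows linearly, so extraction of
    roots removes the width from the bound of Laurent sums; density does the
    rest. *)
Lemma rep_isometric x (c : R) : (forall t, nrm (rep t x) <= c) -> nrm x <= c.
Proof.
have lau N m y d : laurent iota W N m y -> (forall t, nrm (rep t y) <= d) ->
    nrm y <= d.
  move=> Hy Hd.
  have d0 : 0 <= d by apply: le_trans (Hd point); exact: nrm_ge0.
  rewrite -(@ler_pXn2r _ 2) ?nnegrE ?nrm_ge0// -nrm_starM.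
  have cov := crossed_product_covariant hB.
  have := laurentM cov (laurent_star cov Hy) Hy.
  set m' := (_ + m)%N; set N' := (_ + N)%N => Hyy.
  apply: (@power_trick R _ _ m'.+1%:R) => [||k].
  - exact: nrm_ge0.
  - exact: exprn_ge0.
  rewrite -nrm_normalX; last by rewrite starM starK.
  apply: le_trans (@laurent_bound _ _ _ ((d ^+ 2) ^+ (2 ^ k))
    (laurentX cov (2 ^ k) Hyy) _) _ => [t|].
    rewrite rmorphXn rmorphM/= star_morph nrm_normalX; last by rewrite starM starK.
    rewrite nrm_starM lerXn2r ?nnegrE ?exprn_ge0 ?nrm_ge0//.
    by rewrite lerXn2r ?nnegrE ?nrm_ge0// Hd.
  rewrite ler_wpM2r ?exprn_ge0// -natrM ler_nat.
  have : (0 < 2 ^ k)%N by rewrite expn_gt0.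
  by move: (2 ^ k)%N => n n0; nia.
move=> Hc; apply/ler_addgt0Pr => e e0; have e2 : 0 < e / 2 by rewrite divr_gt0.
have [y [[N [m Hy]] xy]] := laurent_dense (crossed_product_covariant hB)
  (crossed_product_generated hB) x e2.
have yc : nrm y <= c + e / 2.
  apply: lau Hy _ => t; rewrite -[rep t y](subrK (rep t x)) addrC.
  apply: le_trans (nrmD _ _) _; apply: lerD => //.
  by rewrite -raddfB nrmBC in xy *; rewrite (le_trans (starhom_contractive _ _))// ltW.
rewrite -[x](subrK y); apply: le_trans (nrmD _ _) _; lra.
Qed.

Lemma rep_injective x y : (forall t, rep t x = rep t y) -> x = y.
Proof.
move=> H; apply/eqP; rewrite -subr_eq0; apply/eqP; apply: nrm_eq0.
by apply: rep_isometric => t; rewrite raddfB/= H subrr nrm0.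
Qed.

(** By isometry, approximations of the path [g] come from a Cauchy family. *)
Lemma rep_closed_range (g : unit_interval R -> A) :
    (forall e : R, 0 < e -> exists b, forall t, nrm (g t - rep t b) <= e) ->
  exists b, forall t, rep t b = g t.
Proof.
move=> H; have [||b Hb] := @complete_approx R B
    (fun e b => forall t, nrm (g t - rep t b) <= e).
- exact: H.
- move=> e d a b Ha Hb; apply: rep_isometric => t; rewrite raddfB/=.
  by apply: le_trans (nrmB_trans (g t) _ _) _; rewrite nrmBC; apply: lerD.
exists b => t; apply/eqP; rewrite -subr_eq0; apply/eqP; apply: nrm_eq0.
apply/ler_addgt0Pr => e e0; have e2 : 0 < e / 2 by rewrite divr_gt0.
have [a Ha] := H _ e2; have := Hb _ a e2 Ha; have := Ha t.
rewrite add0r nrmBC => h1 h2; apply: le_trans (nrmB_trans (rep t a) _ _) _.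
have := starhom_contractive (rep t) (b - a); rewrite raddfB/= => h3; lra.
Qed.

End representations.

(** * The range of the representations *)

Section evaluation_of_coordinates.
Context (R : realType) (A : cstarAlgType R) (V : A).
Hypothesis uV : unitary V.

Lemma eval_radial t (g : R -> R) (cg : continuous g) :
  eval_at uV t (radial cg) = (g (val t))%:C *: 1.
Proof.
apply: eval_eq; apply: fcalc_ext (fcalc_trig (trig_const V (g (val t))%:C)) => z z1.
have -> : on_circle (radial cg) t z =
  (g (nrm (val (to_disk ((val t)%:C * z)) : R[i])))%:C by [].
by rewrite val_dilate// nrm_dilate.
Qed.

Lemma eval_coordinate t : eval_at uV t (disk_coordinate R) = (val t)%:C *: V.
Proof.
apply: eval_eq.
have := fcalc_trig (trigM uV (trig_const V (val t)%:C) (trig_id V)).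
rewrite -scalerAl mul1r; apply: fcalc_ext => z z1.
have -> : on_circle (disk_coordinate R) t z = val (to_disk ((val t)%:C * z)) by [].
by rewrite val_dilate.
Qed.

End evaluation_of_coordinates.

Section interpolation.
Context (R : realType).

Definition clamp (x : R) : R := Num.max 0 (Num.min 1 x).

Lemma clamp_continuous : continuous clamp.
Proof.
move=> x; apply: continuous_max; first exact: cvg_cst.
by apply: continuous_min; [exact: cvg_cst|exact: cvg_id].
Qed.

(** At [x] between [n + 1] and [n + 2] the sum is the point dividing the segment
    from [p n] to [p (n + 1)] in the ratio of the fractional part of [x]: linear
    interpolation delayed by one step, so that all cut-offs vanish for
    [x <= 1]. *)
Lemma delayed_interpolation (A : cstarAlgType R) (p : nat -> A) (v : A) N
    (x e : R) : 0 <= x -> x <= N%:R ->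
    (forall j, (j <= N)%N -> `|x - j%:R| <= 2 -> nrm (v - p j) <= e) ->
  nrm (v - (p 0 + \sum_(j < N) (clamp (x - j%:R - 1))%:C *: (p j.+1 - p j))) <= e.
Proof.
move=> x0 xN close.
pose G n := p 0 + \sum_(j < n) (clamp (x - j%:R - 1))%:C *: (p j.+1 - p j).
suff /(_ N (leqnn N))[Hs _] : forall n, (n <= N)%N ->
    (x <= n%:R + 1 -> nrm (v - G n) <= e) /\ (n%:R + 1 <= x -> G n = p n).
  by apply: Hs; rewrite (le_trans xN)// lerDl.
elim=> [_|n ih nN].
  rewrite /G big_ord0 addr0; split => // x1.
  by apply: close => //; rewrite subr0 ger0_norm//; lra.
have [ih1 ih2] := ih (ltnW nN).
have GS : G n.+1 = G n + (clamp (x - n%:R - 1))%:C *: (p n.+1 - p n).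
  by rewrite /G big_ord_recr/= addrA.
have h1 := close n (ltnW nN); have h2 := close n.+1 nN.
rewrite -[n.+1%:R]natr1 in h2 *.
move: (G n) (G n.+1) GS ih1 ih2 => Gn GSn -> {G ih close} ih1 ih2.
split=> [xn|nx]; last first.
  rewrite /clamp min_l; last by lra.
  rewrite max_r// rmorph1 scale1r ih2; last by lra.
  by rewrite addrC subrK.
have [nx|nx] := leP x (n%:R + 1).
  rewrite /clamp max_l; last by rewrite ge_min; apply/orP; right; lra.
  by rewrite rmorph0 scale0r addr0; exact: ih1.
have -> : clamp (x - n%:R - 1) = x - n%:R - 1.
  by rewrite /clamp min_r; [rewrite max_r//; lra|lra].
have s0 : 0 <= x - n%:R - 1 by lra.
have s1 : 0 <= 1 - (x - n%:R - 1) by lra.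
have {}h1 : nrm (v - p n) <= e by apply: h1; rewrite ger0_norm; lra.
have {}h2 : nrm (v - p n.+1) <= e.
  by apply: h2; rewrite ler_norml; apply/andP; split; lra.
rewrite ih2; last by lra.
move: (x - n%:R - 1) s0 s1 => s s0 s1.
have -> : v - (p n + s%:C *: (p n.+1 - p n)) =
    (1 - s)%:C *: (v - p n) + s%:C *: (v - p n.+1).
  have -> : v - p n.+1 = (v - p n) - (p n.+1 - p n).
    by rewrite opprB addrA subrK.
  rewrite (scalerBr s%:C (_ - _)) rmorphB rmorph1 scalerBl scale1r addrA.
  by rewrite subrK opprD addrA.
apply: le_trans (nrmD _ _) _; rewrite !nrmZ !nrmc_real !ger0_norm//.
have := ler_wpM2l s1 h1; have := ler_wpM2l s0 h2.
move: (nrm _) (nrm _) => u w /= ? ?; lra.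
Qed.

End interpolation.

Section range.
Context (R : realType) (theta : R).
Local Notation C := R[i].
Local Notation CD := (continuousType (disk R) C).
Context (B : cstarAlgType R) (iota : {starhom CD -> B}) (W : B).
Hypothesis hB : is_crossed_product (rotation theta) iota W.
Context (A : cstarAlgType R) (U V : A).
Hypothesis hA : is_rotation_algebra theta U V.
Local Notation rep := (rep hB hA).

Let uU : unitary U. Proof. by case: (rotation_algebra_relation hA). Qed.
Let uV : unitary V. Proof. by case: (rotation_algebra_relation hA). Qed.

Lemma cstar_generated_unitary1 : cstar_generated [set U] 1.
Proof.
have GU : cstar_generated [set U] U by exact: cstar_generated_incl.
have [_ _ _ _ [GM Gs]] := cstar_generated_subalgebra [set U].
by rewrite -uU.1; apply: GM => //; exact: Gs.
Qed.

(** A function of [0 V] is the scalar [f 0], and scalars belong to the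
    C*-algebra of [U] because [star U * U = 1]. *)
Lemma rep_zero b : cstar_generated [set U] (rep (zeroI R) b).
Proof.
have [Gcl G0 GD GZ [GM Gs]] := cstar_generated_subalgebra [set U].
pose S : set B := [set b | cstar_generated [set U] (rep (zeroI R) b)].
suff H : cstar_generated (range iota `|` [set W]) `<=` S.
  by apply: H; rewrite (crossed_product_generated hB).
apply: cstar_generated_ind; first split.
- apply/closed_nrm => x H; move/closed_nrm: Gcl; apply => e e0.
  have [y Sy xy] := H _ e0; exists (rep (zeroI R) y) => //.
  by rewrite -raddfB; apply: le_lt_trans xy; exact: starhom_contractive.
- by rewrite /S/= rmorph0.
- by move=> x y Sx Sy; rewrite /S/= rmorphD; exact: GD.
- by move=> c x Sx; rewrite /S/= linearZ; exact: GZ.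
- split=> [x y Sx Sy|x Sx]; first by rewrite /S/= rmorphM; exact: GM.
  by rewrite /S/= star_morph; exact: Gs.
move=> x []; last by move=> ->; rewrite /S/= rep_W; exact: cstar_generated_incl.
case=> f _ <-; rewrite /S/= rep_iota.
rewrite (@eval_eq _ _ _ _ _ _ (f (to_disk 0) *: 1)).
  by apply: GZ; exact: cstar_generated_unitary1.
apply: fcalc_ext (fcalc_trig (trig_const V (f (to_disk 0)))) => z z1.
by rewrite /on_circle/= rmorph0 mul0r.
Qed.

Lemma rep_constant a : cstar_generated [set U] a -> exists b, forall t, rep t b = a.
Proof.
move: a; apply: cstar_generated_ind; first split.
- apply/closed_nrm => x H; apply: rep_closed_range => e e0.
  have [y [b Hb] xy] := H _ e0; exists b => t; rewrite Hb; exact: ltW.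
- by exists 0 => t; rewrite rmorph0.
- by move=> x y [b Hb] [c Hc]; exists (b + c) => t; rewrite rmorphD/= Hb Hc.
- by move=> c x [b Hb]; exists (c *: b) => t; rewrite linearZ/= Hb.
- split=> [x y [b Hb] [c Hc]|x [b Hb]].
    by exists (b * c) => t; rewrite rmorphM/= Hb Hc.
  by exists (star b) => t; rewrite star_morph Hb.
by move=> _ ->; exists W => t; rewrite rep_W.
Qed.

(** For [a = V] the path comes from the function [g |z| z / |z|], which is
    continuous as [g] vanishes near [0]. Square roots of cut-offs are cut-offs,
    which allows the path of a product to be factored. *)
Lemma rep_cutoff a (g : R -> R) (d : R) : continuous g -> 0 < d ->
    (forall x, 0 <= g x <= 1) -> (forall x, x <= d -> g x = 0) ->
  exists b, forall t, rep t b = (g (val t))%:C *: a.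
Proof.
pose Q : set A := [set a | forall (g : R -> R) (d : R), continuous g -> 0 < d ->
    (forall x, 0 <= g x <= 1) -> (forall x, x <= d -> g x = 0) ->
  exists b, forall t, rep t b = (g (val t))%:C *: a].
suff H : cstar_generated [set U; V] `<=` Q.
  by apply: H; rewrite (rotation_algebra_generated hA).
apply: cstar_generated_ind; first split.
- apply/closed_nrm => x H {}g {}d cg d0 g01 gd; apply: rep_closed_range => e e0.
  have [y Qy xy] := H _ e0; have [b Hb] := Qy g d cg d0 g01 gd.
  exists b => t; rewrite Hb -scalerBr nrmZ nrmc_real.
  have /andP[h0 h1] := g01 (val t); rewrite ger0_norm// -[e]mul1r.
  by apply: ler_pM => //; [exact: nrm_ge0|exact: ltW].
- by move=> h ? _ _ _ _; exists 0 => t; rewrite rmorph0 scaler0.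
- move=> x y Qx Qy h d' ch d0 h01 hd.
  have [b Hb] := Qx h d' ch d0 h01 hd; have [c Hc] := Qy h d' ch d0 h01 hd.
  by exists (b + c) => t; rewrite rmorphD/= Hb Hc scalerDr.
- move=> k x Qx h d' ch d0 h01 hd; have [b Hb] := Qx h d' ch d0 h01 hd.
  by exists (k *: b) => t; rewrite linearZ/= Hb !scalerA mulrC.
- split=> [x y Qx Qy|x Qx] h d' ch d0 h01 hd; last first.
    have [b Hb] := Qx h d' ch d0 h01 hd; exists (star b) => t.
    by rewrite star_morph Hb starZ conj_Creal// complex_real.
  pose s (u : R) := Num.sqrt (h u).
  have cs : continuous s.
    move=> u; apply: (@continuous_comp _ _ _ h Num.sqrt); first exact: ch.
    exact: sqrt_continuous.
  have s01 u : 0 <= s u <= 1.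
    have /andP[h0 h1] := h01 u; rewrite sqrtr_ge0/= -sqrtr1.
    by rewrite ler_wsqrtr.
  have sd u : u <= d' -> s u = 0 by move=> /hd; rewrite /s => ->; rewrite sqrtr0.
  have [b Hb] := Qx s d' cs d0 s01 sd; have [c Hc] := Qy s d' cs d0 s01 sd.
  exists (b * c) => t; rewrite rmorphM/= Hb Hc -scalerAl -scalerAr scalerA.
  rewrite -rmorphM/= -expr2 sqr_sqrtr//.
  by have /andP[] := h01 (val t).
move=> x Hx h d' ch d0 h01 hd.
case: Hx => ->.
  exists (iota (radial ch) * W) => t.
  by rewrite rmorphM/= rep_iota rep_W eval_radial -scalerAl mul1r.
(* [q u * u = h u], as [h] vanishes wherever the denominator is not [u]. *)
pose q (u : R) := h u / Num.max u d'.
have m0 u : 0 < Num.max u d' by rewrite lt_max d0 orbT.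
have cq : continuous q.
  move=> u; apply: cvgM; first exact: ch.
  apply: cvgV; first by rewrite gt_eqF.
  by apply: continuous_max; [exact: cvg_id|exact: cvg_cst].
exists (iota (radial cq * disk_coordinate R)) => t.
rewrite rep_iota rmorphM/= eval_radial eval_coordinate -scalerAl mul1r scalerA.
congr (_ *: _); rewrite -rmorphM/=; congr (_%:C); rewrite /q.
have [td|td] := leP (val t) d'; first by rewrite hd// !mul0r.
by rewrite divfK// gt_eqF// (lt_trans d0).
Qed.

(** Since cut-offs must vanish near [0], the path is interpolated with a delay
    of one step of the subdivision, and uniform continuity absorbs the delay. *)
Lemma rep_surjective (f : continuousType (unit_interval R) A) :
  cstar_generated [set U] (f (zeroI R)) -> exists b, forall t, rep t b = f t.
Proof.
move=> f0; apply: rep_closed_range => e e0.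
have [d d0 Hd] := interval_uniform f e0.
(* A delay of one step puts the nodes used at a point at most two steps away. *)
have [N N0 HN] : exists2 N : nat, 0 < N%:R :> R & 2 < d * N%:R.
  exists (Num.truncn (2 / d)).+1; first by rewrite ltr0n.
  by rewrite mulrC -ltr_pdivrMr//; exact: truncnS_gt.
have pt (x : R) : exists t : unit_interval R, 0 <= x <= 1 -> val t = x.
  have [x01|] := boolP (0 <= x <= 1); last by exists (zeroI R).
  have x01' : x \in `[0 : R, 1]%classic by rewrite inE/= in_itv.
  by exists (exist (fun x => x \in `[0 : R, 1]%classic) x x01').
(* The node [p 0] is [zeroI] itself, so that [f (p 0)] is covered by [f0]. *)
pose p j := if j is 0 then zeroI R else projT1 (cid (pt (j%:R / N%:R))).
have pE j : (j <= N)%N -> val (p j) = j%:R / N%:R.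
  case: j => [_|j jN]; first by rewrite /= mul0r.
  apply: (projT2 (cid (pt (j.+1%:R / N%:R)))).
  by rewrite divr_ge0//= ler_pdivrMr// mul1r ler_nat.
pose g j (x : R) := clamp (N%:R * x - j%:R - 1).
have cut j : exists b, forall t, rep t b = (g j (val t))%:C *: (f (p j.+1) - f (p j)).
  apply: (@rep_cutoff _ (g j) (1 / N%:R)).
  - move=> x.
    apply: (@continuous_comp R R R (fun x => N%:R * x - j%:R - 1) (@clamp R) x);
      last exact: clamp_continuous.
    apply: cvgB; last exact: cvg_cst.
    apply: cvgB; last exact: cvg_cst.
    by apply: cvgM; [exact: cvg_cst|exact: cvg_id].
  - by rewrite divr_gt0.
  - move=> x; rewrite /g /clamp le_max lexx/= ge_max ler01/= ge_min lexx.
    by [].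
  - move=> x; rewrite ler_pdivlMr// => xN; apply/max_idPl.
    rewrite ge_min; apply/orP; right.
    by have : 0 <= j%:R :> R by []; move=> ?; lra.
have [b0 Hb0] := rep_constant f0.
pose b j := projT1 (cid (cut j)).
have bE j t : rep t (b j) = _ := projT2 (cid (cut j)) t.
exists (b0 + \sum_(j < N) b j) => t.
have -> : rep t (b0 + \sum_(j < N) b j) =
    f (p 0) + \sum_(j < N) (g j (val t))%:C *: (f (p j.+1) - f (p j)).
  by rewrite rmorphD/= Hb0 rmorph_sum/=; congr (_ + _); apply: eq_bigr => j _.
have /andP[t0 t1] := interval_itv t.
apply: (@delayed_interpolation R A (fun j => f (p j))).
- by rewrite mulr_ge0.
- by rewrite ler_piMr.
move=> j jN xj; apply: Hd; rewrite pE//.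
rewrite -(@ltr_pM2r _ N%:R)//; apply: le_lt_trans HN.
have -> : `|val t - j%:R / N%:R| * N%:R = `|N%:R * val t - j%:R|.
  by rewrite -{2}[N%:R]gtr0_norm// -normrM mulrBl divfK ?gt_eqF// mulrC.
exact: xj.
Qed.

End range.

Theorem theorem5p3 (R : realType) (theta : R) (htheta : 0 <= theta < 1)
    (B : cstarAlgType R) (iota : {starhom continuousType (disk R) R[i] -> B})
    (W : B) (hB : is_crossed_product (rotation theta) iota W)
    (A : cstarAlgType R) (U V : A) (hA : is_rotation_algebra theta U V) :
  exists F : {starhom B -> continuousType (unit_interval R) A},
    set_bij [set: B]
      [set f : continuousType (unit_interval R) A |
         cstar_generated [set U] (f (zeroI R))]
      F.
Proof.
pose F (b : B) : continuousType (unit_interval R) A :=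
  mkcts (@rep_continuous _ _ _ _ _ hB _ _ _ hA b).
have FL : linear F.
  by move=> c x y; apply/continuousEP => t; exact: linearP.
have FM : monoid_morphism F.
  split=> [|x y]; apply/continuousEP => t; first exact: rmorph1.
  exact: rmorphM.
have FS : {morph F : x / star x}.
  by move=> x; apply/continuousEP => t; exact: star_morph.
pose FLM := GRing.isLinear.Build R[i] B (continuousType (unit_interval R) A) _ F FL.
pose FMM := GRing.isMonoidMorphism.Build B (continuousType (unit_interval R) A) F FM.
pose FSM := isStarMorphism.Build R B (continuousType (unit_interval R) A) F FS.
pose F' : {starhom B -> continuousType (unit_interval R) A} :=
  HB.pack F FLM FMM FSM.
exists F'; split.
- by move=> b _; exact: rep_zero.
- move=> x y _ _ xy; apply: (rep_injective (hB := hB) (hA := hA)) => t.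
  exact: (congr1 (fun f : continuousType _ _ => f t) xy).
- move=> f /= /(rep_surjective hB hA)[b Hb]; exists b => //.
  by apply/continuousEP => t; exact: Hb.
Qed.
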